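(* Let $a<0$, $\beta,\gamma>-1$, and let $n\in\mathbb{N}$ with $n\ge 2$. Then: (1) $L_n^{(\beta,\gamma)}(x;a)\prec L_n^{(\beta+1,\gamma)}(x;a)$ and $L_n^{(\beta+1,\gamma)}(x;a)\prec x\,L_{n-1}^{(\beta+1,\gamma+1)}(x;a)$. (2) On $(a,0)$: $L_n^{(\beta,\gamma+1)}(x;a)\prec L_n^{(\beta,\gamma)}(x;a)$ and $L_n^{(\beta,\gamma)}(x;a)\prec L_{n-1}^{(\beta+1,\gamma+1)}(x;a)$. On $(0,\infty)$: $L_n^{(\beta,\gamma)}(x;a)\prec L_n^{(\beta,\gamma+1)}(x;a)$ and $L_n^{(\beta,\gamma+1)}(x;a)\prec L_{n-1}^{(\beta+1,\gamma+1)}(x;a)$. (3) On $(-\infty,0)$: $H_n^{(\gamma+1)}(x)\prec H_n^{(\gamma)}(x)$ and $H_n^{(\gamma)}(x)\prec H_{n-1}^{(\gamma+1)}(x)$. On $(0,\infty)$: $H_n^{(\gamma)}(x)\prec H_n^{(\gamma+1)}(x)$ and $H_n^{(\gamma+1)}(x)\prec H_{n-1}^{(\gamma+1)}(x)$.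
   Context: Jacobi-Laguerre polynomials: for $a<0$, $\beta,\gamma>-1$ and $n\in\mathbb{N}\cup\{0\}$, $L_n^{(\beta,\gamma)}(x;a)$ is the unique monic polynomial in $x$ of degree $2n$ such that for $k=0,1,\dots,n-1$, $$\int_a^0 x^k L_n^{(\beta,\gamma)}(x;a)(x-a)^\beta|x|^\gamma e^{-x}\,dx=0,\qquad \int_0^\infty x^k L_n^{(\beta,\gamma)}(x;a)(x-a)^\beta x^\gamma e^{-x}\,dx=0.$$ Its zeros are real and simple, $n$ of them in $(a,0)$ and $n$ in $(0,\infty)$. Laguerre-Hermite polynomials: for $\gamma>-1$ and $n\in\mathbb{N}\cup\{0\}$, $H_n^{(\gamma)}(x)$ is the unique monic polynomial of degree $2n$ such that for $k=0,1,\dots,n-1$, $$\int_{-\infty}^0 x^k H_n^{(\gamma)}(x)|x|^\gamma e^{-x^2}\,dx=0,\qquad \int_0^\infty x^k H_n^{(\gamma)}(x)x^\gamma e^{-x^2}\,dx=0.$$ Its zeros are real and simple, $n$ of them negative and $n$ positive. Interlacing: let $(c,d)\subseteq\mathbb{R}$ be an open (possibly unbounded) interval and $p,q$ polynomials, and let $\lambda_1(p)<\cdots<\lambda_k(p)$ and $\lambda_1(q)<\cdots<\lambda_j(q)$ be all the zeros of $p$ and of $q$, respectively, that belong to $(c,d)$, all of them simple. We write $p\prec q$ on $(c,d)$ if either $j=k$ and $\lambda_1(p)<\lambda_1(q)<\lambda_2(p)<\lambda_2(q)<\cdots<\lambda_k(p)<\lambda_k(q)$, or $j=k-1$ and $\lambda_1(p)<\lambda_1(q)<\lambda_2(p)<\lambda_2(q)<\cdots<\lambda_{k-1}(p)<\lambda_{k-1}(q)<\lambda_k(p)$.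 If no interval is mentioned, $(c,d)=\mathbb{R}$. *)

(* Defs.v *)
From HB Require Import structures.
From mathcomp Require Import all_boot all_order all_algebra.
From mathcomp Require Import all_classical all_reals all_analysis.

Set Implicit Arguments.
Unset Strict Implicit.
Unset Printing Implicit Defensive.

Import Order.TTheory GRing.Theory Num.Theory.
Import numFieldNormedType.Exports.

Local Open Scope classical_set_scope.
Local Open Scope ring_scope.

(** The integrals are the extended-real Lebesgue integrals: a divergent
    integral is never equal to [0].  The open intervals keep every base of a
    real power [powR] positive. *)
Definition is_jacobi_laguerre (R : realType) (a beta gamma : R) (n : nat)
    (p : {poly R}) : Prop :=
  [/\ p \is monic, size p = (2 * n).+1 &
      forall k : nat, (k < n)%N ->
        (\int[lebesgue_measure]_(x in `]a, 0%R[)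
           (x ^+ k * p.[x] * (x - a) `^ beta * `|x| `^ gamma
              * expR (- x))%:E = 0)%E /\
        (\int[lebesgue_measure]_(x in `]0%R, +oo[)
           (x ^+ k * p.[x] * (x - a) `^ beta * x `^ gamma
              * expR (- x))%:E = 0)%E].

Definition is_laguerre_hermite (R : realType) (gamma : R) (n : nat)
    (p : {poly R}) : Prop :=
  [/\ p \is monic, size p = (2 * n).+1 &
      forall k : nat, (k < n)%N ->
        (\int[lebesgue_measure]_(x in `]-oo, 0%R[)
           (x ^+ k * p.[x] * `|x| `^ gamma * expR (- x ^+ 2))%:E = 0)%E /\
        (\int[lebesgue_measure]_(x in `]0%R, +oo[)
           (x ^+ k * p.[x] * x `^ gamma * expR (- x ^+ 2))%:E = 0)%E].

(** "The" polynomial with the defining property; [xget] returns the zero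
    polynomial if no polynomial has it. *)
Definition jacobi_laguerre (R : realType) (a beta gamma : R) (n : nat) :
    {poly R} :=
  xget 0 [set p | is_jacobi_laguerre a beta gamma n p].

Definition laguerre_hermite (R : realType) (gamma : R) (n : nat) : {poly R} :=
  xget 0 [set p | is_laguerre_hermite gamma n p].

(** [s] is the increasing list of all the zeros of [p] in [I], and all of them
    are simple. *)
Definition simple_zeros_in (R : realType) (I : interval R) (p : {poly R})
    (s : seq R) : Prop :=
  [/\ sorted <%R s,
      forall x : R, x \in s <-> x \in I /\ root p x &
      forall x : R, x \in s -> mup x p = 1%N].

(** With [s] of size k and [t] of size j, the two families of inequalities
    together form the alternating chain s_0 < t_0 < s_1 < t_1 < ..., which ends
    with t_(k-1) when j = k and with s_(k-1) when j = k - 1. *)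
Definition interlace_on (R : realType) (I : interval R) (p q : {poly R}) :
    Prop :=
  exists s t : seq R,
    [/\ simple_zeros_in I p s, simple_zeros_in I q t,
        size t = size s \/ (size t).+1 = size s,
        forall i : nat, (i < size t)%N -> s`_i < t`_i &
        forall i : nat, (i.+1 < size s)%N -> t`_i < s`_i.+1].

Definition interlace (R : realType) (p q : {poly R}) : Prop :=
  interlace_on `]-oo, +oo[ p q.

(* Main.v *)
Require Import Defs.
From HB Require Import structures.
From mathcomp Require Import all_boot all_order all_algebra.
From mathcomp Require Import all_classical all_reals all_analysis.
From mathcomp Require Import measurable_realfun.
From mathcomp Require Import ring lra zify.

(** Let [w = (x - a)^beta |x|^gamma e^(-x)], [kappa = x - a] and
    [theta = (x kappa w)' / w], a polynomial of degree 2.  Integration by parts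
    on each of the two intervals gives the Pearson identity: the integral of
    [(x kappa f' + theta f) w] vanishes for every polynomial [f].  With
    [q = L_(n-1)^(beta+1,gamma+1)], it follows that
    - [P = L_n^(beta,gamma) = - (x kappa q' + theta q)],
    - [T = L_n^(beta+1,gamma) = P - n x q],
    - [S = L_n^(beta,gamma+1) = P - n kappa q],
    since the right-hand sides satisfy the orthogonality relations that
    characterize the left-hand sides.  At a zero of [x q], each of [P], [T] and
    [S] therefore has the sign opposite to that of [(x q)'], and at a zero of
    [P] both [T * (x q)] and [S * q] are negative.  These signs fix the parity of
    the number of zeros of one polynomial to the left of each zero of another,
    and since the numbers of zeros are known, they force the interlacing.  The
    Laguerre-Hermite case is the same with [w = |x|^gamma e^(-x^2)] and
    [kappa = 1]. *)

Set Implicit Arguments.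
Unset Strict Implicit.
Unset Printing Implicit Defensive.

Import Order.TTheory GRing.Theory Num.Theory.
Import numFieldNormedType.Exports.

Local Open Scope ring_scope.

(** * Zeros of multiple orthogonal polynomials *)

(** All integrals are reduced to two linear forms [L1], [L2] on polynomials, built from the single
    weight [w]. Raising a parameter multiplies [w] by a polynomial [u] among [1], [x], [kappa],
    [x kappa], up to a sign to the left of 0, so all the families are orthogonal for one pair of
    forms and share one Pearson identity. As [u] has constant sign on each interval, counting sign
    changes gives [n] zeros per interval for every family, and from this count follow the uniqueness
    and the existence of the polynomials, which [xget] by itself does not provide.

    The interlacing is first shown for whole lists of zeros and then cut at 0. For [S] the list
    compared with the zeros of [P] is that of [x S]: its chain begins with a zero of [S], but to the
    right of 0 the inserted 0 takes the first place. Hence the order of [P] and [S] differs on the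
    two sides.

    The analytic obstacle is that the weight may be unbounded at finite endpoints. Integration by
    parts is therefore done on compact segments, and the passage to the limit needs an explicit
    integrable majorant. *)

Definition root_poly (R : nzRingType) (s : seq R) : {poly R} :=
  \prod_(z <- s) ('X - z%:P).

Definition constant_sign_on (R : realDomainType) (I : interval R) (u : {poly R}) :=
  {in I, forall x, 0 < u.[x]} \/ {in I, forall x, u.[x] < 0}.

(** The inequality is weak because the polynomials tested contain squares that vanish inside [I]; a
    nonzero value is all that the zero count has to contradict. *)
Definition definite_on (R : realDomainType) (I : interval R) (L : {poly R} -> R) :=
  forall p, p != 0 -> {in I, forall x, 0 <= p.[x]} -> L p != 0.

Definition orthogonal_below (R : nzRingType) (L : {poly R} -> R) (n : nat) (p : {poly R}) :=
  forall k, (k < n)%N -> L ('X^k * p) = 0.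

Lemma orthogonal_size (R : comNzRingType) (L : {scalar {poly R}}) n (p u : {poly R}) :
  orthogonal_below L n p -> (size u <= n)%N -> L (u * p) = 0.
Proof.
move=> Lp su; rewrite -(coefK u) poly_def mulr_suml linear_sum big1 // => i _.
by rewrite -scalerAl linearZ /= Lp ?mulr0 // (leq_trans _ su).
Qed.

Lemma root_in_or_constant_sign (R : rcfType) (I : interval R) (p : {poly R}) :
  (exists2 z, z \in I & root p z) \/ constant_sign_on I p.
Proof.
have [[z zI pz]|nr] := pselect (exists2 z, z \in I & root p z); first by left; exists z.
right; have nz x : x \in I -> p.[x] != 0.
  by move=> xI; apply/negP => px; apply: nr; exists x.
have conv x y z : x \in I -> y \in I -> x <= z -> z <= y -> z \in I.
  case: I {nr nz} => l r; rewrite !itv_boundlr => /andP[lx _] /andP[_ yr] xz zy.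
  apply/andP; split; first exact: le_trans lx _.
  by apply: le_trans yr.
have ivt (f : {poly R}) x y : x \in I -> y \in I -> x <= y -> f.[x] <= 0 -> 0 <= f.[y] ->
   exists2 z, z \in I & root f z.
  move=> xI yI xy fx fy; have [|z] := @poly_ivt _ f x y xy.
    by rewrite fx fy.
  by move=> /andP[xz zy] fz; exists z => //; apply: conv xI yI xz zy.
have [[x xI px]|npos] := pselect (exists2 x, x \in I & 0 < p.[x]); last first.
  by right=> x xI; rewrite ltNge; apply/negP => px; apply: npos; exists x; rewrite // lt_def nz.
left=> y yI; rewrite ltNge; apply/negP => py; apply: nr.
have [xy|/ltW yx] := leP x y; last exact: ivt yI xI yx py (ltW px).
have [||z zI] := ivt (- p) x y xI yI xy; rewrite ?hornerN ?oppr_le0 ?oppr_ge0 // ?ltW //.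
by rewrite rootN => rz; exists z.
Qed.

(* Removing a root of I flips its membership in s, so that s ends up listing the
   points of I where p changes sign. *)
Lemma sign_change_factorization (R : rcfType) (I : interval R) (p : {poly R}) : p != 0 ->
  exists s r, [/\ uniq s, {subset s <= I}, p = root_poly s * r, r != 0 &
   {in I, forall x, 0 <= r.[x]} \/ {in I, forall x, r.[x] <= 0}].
Proof.
have [m] := ubnP (size p); elim: m p => // m IH p sp p0.
have [[z zI]|cs] := root_in_or_constant_sign I p; last first.
  exists [::], p; split=> //; first by rewrite /root_poly big_nil mul1r.
  by case: cs => cs; [left|right] => x /cs /ltW.
move=> /factor_theorem[p' pE].
have p'0 : p' != 0 by apply: contraNneq p0 => p'0; rewrite pE p'0 mul0r.
have [|s [r [us sI p'E r0 cr]]] := IH p' _ p'0.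
  by move: sp; rewrite pE size_Mmonic ?monicXsubC // size_XsubC addn2.
have [zs|zs] := boolP (z \in s); last first.
  exists (z :: s), r; split=> //=; first by rewrite zs.
    by move=> x; rewrite inE => /predU1P[->|/sI].
  by rewrite /root_poly big_cons pE p'E mulrC mulrA.
exists (rem z s), (('X - z%:P) ^+ 2 * r); split.
- exact: rem_uniq.
- by move=> x /mem_rem /sI.
- rewrite pE p'E /root_poly (big_rem z) //=; ring.
- by rewrite mulf_neq0 // expf_neq0 // polyXsubC_eq0.
- by case: cr => cr; [left|right] => x xI; rewrite hornerM horner_exp;
    [rewrite mulr_ge0 ?sqr_ge0 ?cr|rewrite mulr_ge0_le0 ?sqr_ge0 ?cr].
Qed.

Lemma root_poly_monic (R : nzRingType) (s : seq R) : root_poly s \is monic.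
Proof. exact: monic_prod_XsubC. Qed.

(** With fewer than [n] sign changes in [I], the monic polynomial vanishing at them would be an
    admissible test polynomial. Its product with [u * p] is a square times a factor of one sign, on
    which a definite form cannot vanish. *)
Lemma orthogonal_zeros (R : rcfType) (I : interval R) (L : {scalar {poly R}})
    (u p : {poly R}) n :
  definite_on I L -> constant_sign_on I u -> u != 0 -> p != 0 ->
  orthogonal_below L n (u * p) ->
  exists s, [/\ uniq s, {subset s <= I}, all (root p) s & size s = n].
Proof.
move=> dL cu u0 p0 Lp.
have [s [r [us sI pE r0 cr]]] := sign_change_factorization I p0.
have [sn|ns] := ltnP (size s) n; last first.
  exists (take n s); split; [exact: take_uniq|by move=> x /mem_take /sI| |exact: size_takel].
  apply/allP => x /mem_take xs.
  by rewrite pE rootM /root_poly root_prod_XsubC xs.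
have : L (root_poly s * (u * p)) = 0.
  by apply: orthogonal_size Lp _; rewrite /root_poly size_prod_XsubC.
have -> : root_poly s * (u * p) = root_poly s ^+ 2 * (u * r) by rewrite pE; ring.
have nz : root_poly s ^+ 2 * (u * r) != 0.
  by apply: mulf_neq0; [rewrite expf_neq0 // monic_neq0 // root_poly_monic|exact: mulf_neq0].
have sg : {in I, forall x, 0 <= (u * r).[x]} \/ {in I, forall x, (u * r).[x] <= 0}.
  case: cu => cu; case: cr => cr; [left|right|right|left] => x xI; rewrite hornerM;
  move: (cu x xI) (cr x xI) => /ltW ? ?.
  - exact: mulr_ge0.
  - exact: mulr_ge0_le0.
  - exact: mulr_le0_ge0.
  - exact: mulr_le0.
case: sg => sg LE.
- have : L (root_poly s ^+ 2 * (u * r)) != 0.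
    by apply: dL => // x xI; rewrite hornerM horner_exp mulr_ge0 ?sqr_ge0 ?sg.
  by rewrite LE eqxx.
- have : L (- (root_poly s ^+ 2 * (u * r))) != 0.
    apply: dL => [|x xI]; first by rewrite oppr_eq0.
    by rewrite hornerN oppr_ge0 hornerM horner_exp mulr_ge0_le0 ?sqr_ge0 ?sg.
  by rewrite linearN LE oppr0 eqxx.
Qed.

(** An Angelesco system consists of measures on disjoint intervals, here separated by 0. The
    polynomial [u] is the factor by which the weight behind both forms is multiplied. *)
Record angelesco_system (R : realDomainType) (I1 I2 : interval R) (L1 L2 : {poly R} -> R)
  (u : {poly R}) : Prop := AngelescoSystem {
  angelesco_neg : {in I1, forall x, x < 0};
  angelesco_pos : {in I2, forall x, 0 < x};
  angelesco_definite1 : definite_on I1 L1;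
  angelesco_definite2 : definite_on I2 L2;
  angelesco_sign1 : constant_sign_on I1 u;
  angelesco_sign2 : constant_sign_on I2 u;
  angelesco_neq0 : u != 0 }.

Definition multiple_orthogonal (R : nzRingType) (L1 L2 : {poly R} -> R)
    (u : {poly R}) (n : nat) (p : {poly R}) :=
  [/\ p \is monic, size p = (2 * n).+1, orthogonal_below L1 n (u * p) &
      orthogonal_below L2 n (u * p)].

(** Neither the degree of [p] nor its leading coefficient is fixed, so that the count also applies
    to a difference of two candidates and to a solution of a linear system. *)
Lemma angelesco_zeros (R : rcfType) (I1 I2 : interval R)
    (L1 L2 : {scalar {poly R}}) (u p : {poly R}) n :
  angelesco_system I1 I2 L1 L2 u ->
  p != 0 -> orthogonal_below L1 n (u * p) -> orthogonal_below L2 n (u * p) ->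
  exists s1 s2, [/\ uniq (s1 ++ s2), {subset s1 <= I1} /\ {subset s2 <= I2},
    all (root p) (s1 ++ s2), size s1 = n & size s2 = n].
Proof.
case=> ng ps d1 d2 c1 c2 u0 p0 o1 o2.
have [s1 [us1 sI1 rs1 z1]] := orthogonal_zeros d1 c1 u0 p0 o1.
have [s2 [us2 sI2 rs2 z2]] := orthogonal_zeros d2 c2 u0 p0 o2.
exists s1, s2; split; [|by []|by rewrite all_cat rs1|by []|by []].
rewrite cat_uniq us1 us2 andbT /=; apply/hasPn => x /sI2 /ps x0; apply/negP => /sI1 /ng.
by rewrite ltNge ltW.
Qed.

(** The difference of two candidates is again orthogonal, but its degree is below [2n] since the
    leading terms cancel; [2n] distinct zeros are then too many. *)
Lemma multiple_orthogonal_unique (R : rcfType) (I1 I2 : interval R)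
    (L1 L2 : {scalar {poly R}}) (u p q : {poly R}) n :
  angelesco_system I1 I2 L1 L2 u ->
  multiple_orthogonal L1 L2 u n p -> multiple_orthogonal L1 L2 u n q -> p = q.
Proof.
move=> sys [mp sp p1 p2] [mq sq q1 q2]; apply/eqP; rewrite -subr_eq0.
apply/negPn/negP => pq0.
have [||s1 [s2 [us _ rs z1 z2]]] := angelesco_zeros (n := n) sys pq0.
- by move=> k kn; rewrite !mulrBr linearB /= p1 // q1 // subrr.
- by move=> k kn; rewrite !mulrBr linearB /= p2 // q2 // subrr.
have := max_poly_roots pq0 rs us; rewrite size_cat z1 z2 addnn -mul2n ltnNge => /negP[].
apply/leq_sizeP => j; rewrite leq_eqVlt coefB => /predU1P[<-|nj].
  move/monicP: mp; move/monicP: mq; rewrite /lead_coef sp sq /= => -> ->.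
  by rewrite subrr.
by rewrite !nth_default ?subrr // ?sp ?sq.
Qed.

(** There are [2n] linear conditions on [2n + 1] coefficients, hence a nonzero solution. Its [2n]
    distinct zeros force the degree to be exactly [2n], so it can be normalized. *)
Lemma multiple_orthogonal_exists (R : rcfType) (I1 I2 : interval R)
    (L1 L2 : {scalar {poly R}}) (u : {poly R}) n :
  angelesco_system I1 I2 L1 L2 u -> exists p, multiple_orthogonal L1 L2 u n p.
Proof.
move=> sys.
pose M : 'M[R]_((2 * n).+1, n + n) := \matrix_(j, k)
  match fintype.split k with inl k => L1 ('X^k * (u * 'X^j)) | inr k => L2 ('X^k * (u * 'X^j)) end.
have kM : kermx M != 0.
  rewrite -mxrank_eq0 mxrank_ker subn_eq0 -ltnNge.
  by apply: leq_ltn_trans (rank_leq_col M) _; lia.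
pose v := nz_row (kermx M).
have v0 : v != 0 by rewrite nz_row_eq0.
have vM : v *m M = 0 by apply/sub_kermxP; exact: nz_row_sub.
pose p := rVpoly v.
have p0 : p != 0 by apply: contraNneq v0 => p0; rewrite -(rVpolyK v) -/p p0 linear0.
have expand (L : {scalar {poly R}}) k :
    L ('X^k * (u * p)) = \sum_j v 0 j * L ('X^k * (u * 'X^j)).
  rewrite /p /rVpoly poly_def !mulr_sumr linear_sum; apply: eq_bigr => j _.
  by rewrite valK -!scalerAr linearZ.
have o1 : orthogonal_below L1 n (u * p).
  move=> k kn; have /matrixP/(_ 0 (lshift n (Ordinal kn))) := vM.
  rewrite !mxE expand => E; rewrite -[RHS]E; apply: eq_bigr => j _; rewrite mxE.
  by rewrite (unsplitK (inl (Ordinal kn))).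
have o2 : orthogonal_below L2 n (u * p).
  move=> k kn; have /matrixP/(_ 0 (rshift n (Ordinal kn))) := vM.
  rewrite !mxE expand => E; rewrite -[RHS]E; apply: eq_bigr => j _; rewrite mxE.
  by rewrite (unsplitK (inr (Ordinal kn))).
have [s1 [s2 [us _ rs z1 z2]]] := angelesco_zeros sys p0 o1 o2.
have := max_poly_roots p0 rs us; rewrite size_cat z1 z2 => sp.
have lp : lead_coef p != 0 by rewrite lead_coef_eq0.
exists ((lead_coef p)^-1 *: p); split.
- by rewrite monicE lead_coefZ mulVf.
- rewrite size_scale ?invr_eq0 //; apply/eqP; rewrite eqn_leq; apply/andP; split.
    exact: size_poly.
  by rewrite mul2n -addnn.
- by move=> k kn; rewrite -!scalerAr linearZ /= o1 ?mulr0.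
- by move=> k kn; rewrite -!scalerAr linearZ /= o2 ?mulr0.
Qed.

(** The product form records at once that [p] is monic, that it has no other zeros and, with strict
    sorting, that they are simple. From here on the arguments concern lists only. *)
Definition zeros_split (R : realDomainType) (I1 I2 : interval R) (n : nat)
    (p : {poly R}) (s1 s2 : seq R) :=
  [/\ sorted <%R (s1 ++ s2), {subset s1 <= I1} /\ {subset s2 <= I2},
    p = root_poly (s1 ++ s2), size s1 = n & size s2 = n].

Lemma multiple_orthogonal_factor (R : rcfType) (I1 I2 : interval R)
    (L1 L2 : {scalar {poly R}}) (u p : {poly R}) n :
  angelesco_system I1 I2 L1 L2 u -> multiple_orthogonal L1 L2 u n p ->
  exists s1 s2, zeros_split I1 I2 n p s1 s2.
Proof.
move=> sys [mp sp o1 o2].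
have [s1 [s2 [us [sI1 sI2] rs z1 z2]]] := angelesco_zeros sys (monic_neq0 mp) o1 o2.
have pm : perm_eq (sort <=%R s1 ++ sort <=%R s2) (s1 ++ s2).
  by apply: perm_cat; rewrite perm_sort.
exists (sort <=%R s1), (sort <=%R s2); split; rewrite ?size_sort //.
- rewrite lt_sorted_uniq_le (perm_uniq pm) us /=.
  rewrite sorted_pairwise; last exact: le_trans.
  rewrite pairwise_cat -!sorted_pairwise; try exact: le_trans.
  rewrite !sort_sorted ?andbT; try exact: le_total.
  apply/allrelP => x y; rewrite !mem_sort => /sI1 /(angelesco_neg sys) x0.
  move=> /sI2 /(angelesco_pos sys) y0.
  by rewrite ltW // (lt_trans x0).
- by split=> x; rewrite mem_sort; [move/sI1|move/sI2].
- rewrite /root_poly (perm_big _ pm) /=.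
  rewrite [LHS](@all_roots_prod_XsubC _ p (s1 ++ s2)) ?(monicP mp) ?scale1r //.
  + by rewrite size_cat z1 z2 sp; lia.
  + by rewrite uniq_rootsE.
Qed.

(** * Interleaving from signs *)

Definition interleaved (R : numDomainType) (s t : seq R) :=
  (forall i, (i < size t)%N -> s`_i < t`_i) /\
  (forall i, (i.+1 < size s)%N -> t`_i < s`_i.+1).

(** Each zero above [y] contributes one negative factor. Their number is the size minus the count
    below [y], and the parity of a difference is an exclusive or. *)
Lemma root_poly_lt0 (R : realDomainType) (s : seq R) (y : R) : y \notin s ->
  ((root_poly s).[y] < 0) = odd (size s) (+) odd (count (< y) s).
Proof.
elim: s => [_|z s IH]; first by rewrite /root_poly big_nil hornerC ltr10.
rewrite inE negb_or => /andP[yz ys]; rewrite /root_poly big_cons -/(root_poly s).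
have T0 : (root_poly s).[y] != 0.
  by apply: contraNneq ys => E; rewrite -root_prod_XsubC /root E.
have flip : (0 < (root_poly s).[y]) = ~~ ((root_poly s).[y] < 0) by rewrite lt_def T0 /= leNgt.
rewrite hornerM hornerXsubC /= !oddD oddb; have [zy|] := ltrP z y.
  by rewrite pmulr_rlt0 ?subr_gt0 // IH //= -addTb; do 2 case: odd.
rewrite le_eqVlt (negbTE yz) /= => zy.
by rewrite nmulr_rlt0 ?subr_lt0 // flip IH //=; do 2 case: odd.
Qed.

Lemma count_lt_sorted_nth (R : realDomainType) (s : seq R) i : sorted <%R s ->
  (i < size s)%N -> count (< s`_i) s = i.
Proof.
elim: s i => // z s IH i; rewrite /= lt_path_sortedE => /andP[zs ss].
case: i => [_|i]; last first.
  rewrite ltnS => si; rewrite /= IH //.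
  by move/allP: zs => ->; rewrite ?mem_nth.
rewrite /= ltxx add0n; apply/eqP; rewrite -leqn0 leqNgt -has_count; apply/hasPn => x xs.
by rewrite /= -leNgt ltW // (allP zs).
Qed.

(** At a zero, the derivative equals the product of the other factors, and exactly [i] of the other
    zeros lie below [s_i]. *)
Lemma deriv_root_poly_lt0 (R : realDomainType) (s : seq R) i :
  sorted <%R s -> (i < size s)%N ->
  ((root_poly s)^`().[s`_i] < 0) = odd (size s).-1 (+) odd i.
Proof.
move=> ss si; have ti : s`_i \in s by rewrite mem_nth.
have us : uniq s by move: ss; rewrite lt_sorted_uniq_le => /andP[].
have -> : root_poly s = ('X - (s`_i)%:P) * root_poly (rem s`_i s).
  by rewrite /root_poly (big_rem s`_i).
rewrite derivM derivXsubC hornerD !hornerM hornerXsubC subrr mul0r addr0 hornerC mul1r.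
rewrite root_poly_lt0 ?mem_rem_uniqF // size_rem // -[in RHS](count_lt_sorted_nth ss si).
by rewrite [in RHS](permP (perm_to_rem ti)) /= ltxx.
Qed.

Lemma deriv_root_poly_neq0 (R : idomainType) (s : seq R) (y : R) : uniq s -> y \in s ->
  (root_poly s)^`().[y] != 0.
Proof.
move=> us ys; rewrite /root_poly (big_rem y) //= -/(root_poly _).
rewrite derivM derivXsubC hornerD !hornerM hornerXsubC subrr mul0r addr0 hornerC mul1r.
by rewrite -/(root _ _) root_prod_XsubC mem_rem_uniqF.
Qed.

Lemma count_lt_eq (R : realDomainType) (s : seq R) k (y : R) : sorted <%R s -> (k <= size s)%N ->
  ((0 < k)%N -> s`_k.-1 < y) -> ((k < size s)%N -> y <= s`_k) -> count (< y) s = k.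
Proof.
move=> /(sub_sorted (@ltW _ R)) ss ks lo hi; case: (ltngtP (count (< y) s) k) => // c.
- have k0 : (0 < k)%N by case: k c {ks lo hi}.
  have : y <= s`_k.-1.
    by apply: nth_count_ge => //; rewrite -ltnS prednK // c.
  by rewrite leNgt lo.
- have := nth_count_lt 0 ss c; rewrite ltNge hi //.
  by apply: leq_trans c _; exact: count_size.
Qed.

Lemma lt_nth_of_count (R : realDomainType) (s : seq R) (y : R) j : sorted <%R s ->
  (j < count (< y) s)%N -> s`_j < y.
Proof. by move=> /(sub_sorted (@ltW _ R)) ss; exact: nth_count_lt. Qed.

Lemma gt_nth_of_count (R : realDomainType) (s : seq R) (y : R) j : sorted <%R s -> y \notin s ->
  (count (< y) s <= j < size s)%N -> y < s`_j.
Proof.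
move=> /(sub_sorted (@ltW _ R)) ss ys cj; rewrite lt_neqAle nth_count_ge // andbT.
by apply: contraNneq ys => ->; rewrite mem_nth //; case/andP: cj.
Qed.

(* The counts increase strictly with i because their parities alternate, and the
   sizes leave no room for any jump larger than 1. *)
Lemma count_lt_of_parity (R : realDomainType) (s t : seq R) e :
  sorted <%R t -> (e <= 1)%N ->
  (size s <= size t + e <= (size s).+1)%N ->
  (forall i, (i < size t)%N -> odd (count (< t`_i) s) = odd (i + e)) ->
  forall i, (i < size t)%N -> count (< t`_i) s = (i + e)%N.
Proof.
move=> st e1 se par.
pose d i := count (< t`_i) s.
have dS i : (i.+1 < size t)%N -> (d i < d i.+1)%N.
  move=> it; have le : (d i <= d i.+1)%N.
    apply: sub_count => x /= xi; apply: lt_trans xi _.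
    by move/(sortedP 0): st => /(_ _ it).
  rewrite ltn_neqAle le andbT; apply/eqP => E.
  have := par _ it; have := par _ (ltnW it); rewrite -/(d i) -/(d i.+1) -E => ->.
  by rewrite addSn /=; case: odd.
have lo i : (i < size t)%N -> (i + e <= d i)%N.
  elim: i => [t0|i IH it]; last by have := IH (ltnW it); have := dS i it; lia.
  have := par _ t0; rewrite -/(d 0%N) add0n; case: e e1 {se par} => [//|[|//]] _ /=.
  by case: (d 0%N).
have hi k : (k < size t)%N -> (d (size t - k.+1) + k <= size s)%N.
  elim: k => [t0|k IH kt].
    by rewrite addn0 count_size.
  have := dS (size t - k.+2)%N; have -> : (size t - k.+2).+1 = (size t - k.+1)%N by lia.
  by have := IH (ltnW kt); lia.
move=> i it; have := hi (size t - i.+1)%N; have := lo i it; have := par i it.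
rewrite (_ : size t - (size t - i.+1).+1 = i)%N; last by lia.
rewrite -/(d i) => pd lod /(_ ltac:(lia)) hid; case/andP: se => se _.
move: (d i) (size s) (size t) it se pd lod hid => m a b it se pd lod hid.
have : (m <= (i + e).+1)%N by lia.
rewrite leq_eqVlt => /predU1P[E|]; last by lia.
by move: pd; rewrite E /=; case: odd.
Qed.

(** The derivative alternates in sign along [t], hence so does [root_poly s]. At the last element of
    [t] the derivative is positive, so an odd number of elements of [s] lies above it; this fixes
    the offset [e = 1] in [count_lt_of_parity]. *)
Lemma interleaved_of_deriv (R : realDomainType) (s t : seq R) :
  sorted <%R s -> sorted <%R t -> size s = (size t).+1 ->
  {in t, forall y, (root_poly s).[y] * (root_poly t)^`().[y] < 0} -> interleaved s t.
Proof.
move=> ss st sz neg.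
have nots y : y \in t -> y \notin s.
  move=> /neg; apply: contraTN; rewrite -root_prod_XsubC => /eqP E.
  by rewrite /root_poly E mul0r ltxx.
have cnt : forall i, (i < size t)%N -> count (< t`_i) s = (i + 1)%N.
  apply: count_lt_of_parity => //; first by lia.
  move=> i it; have yt : t`_i \in t by rewrite mem_nth.
  have := neg _ yt; rewrite mulr_lt0 => /and3P[_ _].
  rewrite root_poly_lt0 ?nots // deriv_root_poly_lt0 // sz /= addn1 /=.
  by case: (size t) it => // m _ /=; do 3 case: odd.
split=> i hi.
  by apply: lt_nth_of_count => //; rewrite cnt // addn1.
have it : (i < size t)%N by rewrite -ltnS -sz.
by apply: gt_nth_of_count; rewrite ?nots ?mem_nth // cnt //; lia.
Qed.

Lemma count_of_interleaved (R : realDomainType) (p v : seq R) :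
  sorted <%R v -> size p = (size v).+1 -> interleaved p v ->
  forall i, (i < size p)%N -> count (< p`_i) v = i.
Proof.
move=> sv sz [lt1 lt2] i ip; apply: count_lt_eq => //; first by lia.
- by case: i ip => // i ip _; exact: lt2.
- by move=> iv; exact/ltW/lt1.
Qed.

(** The list [v] serves as reference: exactly [i] of its elements lie below [p_i], which fixes the
    sign of [root_poly v] there, hence that of [root_poly u]. The surplus [e] of [u] over [p] is 0
    for the zeros of [T] and 1 for those of [x S]. *)
Lemma counts_of_sign (R : realDomainType) (p v u : seq R) e :
  sorted <%R p -> sorted <%R v ->
  size p = (size v).+1 -> interleaved p v -> size u = (size p + e)%N -> (e <= 1)%N ->
  {in p, forall y, (root_poly u).[y] * (root_poly v).[y] < 0} ->
  {in p, forall y, y \notin u} /\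
  forall i, (i < size p)%N -> count (< p`_i) u = (i + e)%N.
Proof.
move=> sp sv sz alt su e1 neg.
have notin (w w' : seq R) : {in p, forall y, (root_poly w).[y] * (root_poly w').[y] < 0} ->
    {in p, forall y, y \notin w}.
  move=> ng y /ng; apply: contraTN; rewrite -root_prod_XsubC => /eqP E.
  by rewrite /root_poly E mul0r ltxx.
have nu := notin _ _ neg.
have nv : {in p, forall y, y \notin v}.
  by apply: (notin _ u) => y /neg; rewrite mulrC.
split=> //; apply: count_lt_of_parity => //; first by lia.
move=> i ip; have yp : p`_i \in p by rewrite mem_nth.
have := neg _ yp; rewrite mulr_lt0 => /and3P[_ _].
rewrite !root_poly_lt0 ?nu ?nv // (count_of_interleaved sv sz alt) // su sz.
rewrite addSn /= !oddD.
by do 4 case: odd.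
Qed.

Lemma interleaved_of_sign (R : realDomainType) (p v u : seq R) :
  sorted <%R p -> sorted <%R v -> sorted <%R u ->
  size p = (size v).+1 -> interleaved p v -> size u = size p ->
  {in p, forall y, (root_poly u).[y] * (root_poly v).[y] < 0} -> interleaved p u.
Proof.
move=> sp sv su sz alt zu neg.
have [|nu cnt] := counts_of_sign (e := 0) sp sv sz alt _ isT neg; first by rewrite addn0.
split=> i hi.
- have ip : (i < size p)%N by rewrite -zu.
  by apply: gt_nth_of_count; rewrite ?nu ?mem_nth // cnt // addn0 leqnn.
- by apply: lt_nth_of_count => //; rewrite cnt // addn0.
Qed.

(** Having one element more than [p], the list [u] also has an element below the first of [p], so
    now the chain begins with [u]. *)
Lemma interleaved_of_signS (R : realDomainType) (p v u : seq R) :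
  sorted <%R p -> sorted <%R v -> sorted <%R u ->
  size p = (size v).+1 -> interleaved p v -> size u = (size p).+1 ->
  {in p, forall y, (root_poly u).[y] * (root_poly v).[y] < 0} -> interleaved u p.
Proof.
move=> sp sv su sz alt zu neg.
have [|nu cnt] := counts_of_sign (e := 1) sp sv sz alt _ isT neg; first by rewrite addn1.
split=> i hi.
- by apply: lt_nth_of_count => //; rewrite cnt // addn1.
- have ip : (i < size p)%N by rewrite -ltnS -zu.
  by apply: gt_nth_of_count; rewrite ?nu ?mem_nth // cnt // addn1 leqnn.
Qed.

(** * Pearson identities *)

(** When [(x kappa w)' = theta w], this is [(x kappa w p)' / w], so that its integral against [w] is
    a boundary term. *)
Definition pearson_operator (R : nzRingType) (kappa theta p : {poly R}) :=
  'X * kappa * p^`() + theta * p.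

Definition pearson (R : nzRingType) (L : {poly R} -> R) (kappa theta : {poly R}) :=
  forall p, L (pearson_operator kappa theta p) = 0.

Section PearsonOrthogonality.
Variables (R : comNzRingType) (L : {scalar {poly R}}) (kappa theta q : {poly R}) (m : nat).
Hypotheses (pearsonL : pearson L kappa theta) (orthq : orthogonal_below L m ('X * kappa * q)).
Let Q := pearson_operator kappa theta q.

Let orth_natmul k j : (k < m)%N \/ j = 0%N -> L ('X^k * ('X * kappa * q) *+ j) = 0.
Proof. by case=> [km|->]; rewrite ?mulr0n ?linear0 // raddfMn /= orthq // mul0rn. Qed.

(** By the product rule, [x^k Q] is a Pearson term minus [k] times the moment of index [k - 1] of
    [x kappa q]. The drop of the index by one is what improves the order from [m] to [m + 1]; for
    [k = 0] the factor [k] removes the moment. *)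
Lemma orthogonal_pearson : orthogonal_below L m.+1 Q.
Proof.
move=> k km.
have -> : 'X^k * Q = pearson_operator kappa theta ('X^k * q) -
    'X^(k.-1) * ('X * kappa * q) *+ k.
  by rewrite /Q /pearson_operator derivM derivXn; ring.
rewrite linearB /= pearsonL orth_natmul ?subrr //.
by case: k km => [|k] km; [right|left].
Qed.

(* In this lemma and the next one, the added multiple of [q] makes the Pearson
   identity leave the coefficient [m - k] in front of the [k]-th moment of
   [x kappa q], which kills the only moment, [k = m], not covered by [orthq]. *)
Lemma orthogonal_pearson_mulX :
  orthogonal_below L m.+1 ('X * (Q + (kappa * q) *+ m.+1)).
Proof.
move=> k km.
have -> : 'X^k * ('X * (Q + (kappa * q) *+ m.+1)) =
    pearson_operator kappa theta ('X^(k.+1) * q) + 'X^k * ('X * kappa * q) *+ (m.+1 - k.+1).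
  rewrite mulrnBr // /Q /pearson_operator derivM derivXn /= exprS; ring.
rewrite linearD /= pearsonL orth_natmul ?addr0 //.
by move: km; rewrite ltnS leq_eqVlt => /predU1P[->|]; [right; rewrite subnn|left].
Qed.

Lemma orthogonal_pearson_mulXsubC a : kappa = 'X - a%:P ->
  orthogonal_below L m.+1 (kappa * (Q + ('X * q) *+ m.+1)).
Proof.
move=> kE k km.
have -> : 'X^k * (kappa * (Q + ('X * q) *+ m.+1)) =
    pearson_operator kappa theta ('X^k * (kappa * q)) +
    'X^k * ('X * kappa * q) *+ (m.+1 - k.+1) + a *: ('X^(k.-1) * ('X * kappa * q) *+ k).
  rewrite mulrnBr // -mul_polyC /Q /pearson_operator !derivM derivXn.
  have -> : kappa^`() = 1 by rewrite kE derivXsubC.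
  case: k {km} => [|k] /=; first by rewrite !mulr0n expr0; ring.
  (* Differentiating [x^k] leaves [k x^(k-1) kappa], that is [k x^k - a k x^(k-1)], as a multiplier
     of [x kappa q]; this is the origin of the term with factor [a]. *)
  have -> : a%:P = 'X - kappa by rewrite kE; ring.
  by rewrite exprS; ring.
rewrite 2!linearD linearZ /= pearsonL !orth_natmul ?mulr0 ?addr0 //.
  by case: k km => [|k] km; [right|left].
by move: km; rewrite ltnS leq_eqVlt => /predU1P[->|]; [right; rewrite subnn|left].
Qed.
End PearsonOrthogonality.

(* The monic polynomials [P] ([v = 0]), [S] ([v = kappa]) and [T] ([v = 'X]) of
   the header. *)
Definition raised (R : fieldType) (kappa theta v q : {poly R}) n :=
  (lead_coef theta)^-1 *: (pearson_operator kappa theta q + (v * q) *+ n).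

(** Since [theta] has degree 2, the product [theta * q] has degree [2m + 2], while all other terms
    have degree at most [2m + 1] and cannot affect the leading coefficient. *)
Lemma raised_monic (R : fieldType) (kappa theta v q : {poly R}) m n :
  (size kappa <= 2)%N -> size theta = 3%N -> (size v <= 2)%N ->
  q \is monic -> size q = (2 * m).+1 ->
  raised kappa theta v q n \is monic /\ size (raised kappa theta v q n) = (2 * m.+1).+1.
Proof.
move=> sk st sv mq sq.
have t0 : lead_coef theta != 0 by rewrite lead_coef_eq0 -size_poly_eq0 st.
have stq : size (theta * q) = (2 * m.+1).+1.
  by rewrite size_Mmonic // ?sq ?st -?size_poly_eq0 ?st //; lia.
have small : (size ('X * kappa * q^`() + (v * q) *+ n)%R < size (theta * q)%R)%N.
  rewrite stq; apply: leq_ltn_trans (size_polyD _ _) _; rewrite gtn_max; apply/andP; split.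
    have h1 := size_polyMleq ('X * kappa) q^`(); have h2 := size_polyMleq 'X kappa.
    have h3 := lt_size_deriv (monic_neq0 mq).
    move: h1 h2 h3; rewrite size_polyX sq.
    move: (size ('X * kappa * _)) (size ('X * kappa)) (size q^`()) (size kappa) sk => A B C D.
    by lia.
  rewrite -mulr_natr; apply: leq_ltn_trans (size_polyMleq _ _) _.
  have h1 := size_polyMleq v q; have h2 : (size (n%:R : {poly R}) <= 1)%N.
    by rewrite -polyC_natr size_polyC_leq1.
  move: h1 h2; rewrite sq; move: (size (v * q)) (size (n%:R : {poly R})) (size v) sv => A B C; lia.
have E : raised kappa theta v q n =
    (lead_coef theta)^-1 *: (theta * q + ('X * kappa * q^`() + (v * q) *+ n)).
  by rewrite /raised /pearson_operator; congr (_ *: _); ring.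
rewrite E size_scale ?invr_eq0 // size_polyDl // monicE lead_coefZ lead_coefDl //.
by rewrite lead_coef_Mmonic // mulVf.
Qed.

(** The conditions at 0 are there because 0 is a zero of [x q] that belongs to neither interval.
    Together with the negative leading coefficient of [theta] they determine the signs of [P], [S]
    and [T] at 0. *)
Record pearson_system (R : realDomainType) (I1 I2 : interval R) (L1 L2 : {poly R} -> R)
  (kappa theta : {poly R}) : Prop := PearsonSystem {
  pearson_neg : {in I1, forall x, x < 0};
  pearson_pos : {in I2, forall x, 0 < x};
  pearson_definite1 : definite_on I1 L1;
  pearson_definite2 : definite_on I2 L2;
  pearson_kappa1 : {in I1, forall x, 0 < kappa.[x]};
  pearson_kappa2 : {in I2, forall x, 0 < kappa.[x]};
  pearson_kappa0 : 0 < kappa.[0];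
  pearson_size_kappa : (size kappa <= 2)%N;
  pearson_size_theta : size theta = 3%N;
  pearson_lead_theta : lead_coef theta < 0;
  pearson_theta0 : 0 < theta.[0];
  pearson_eq1 : pearson L1 kappa theta;
  pearson_eq2 : pearson L2 kappa theta }.

Section PearsonInterlacing.
Variables (R : rcfType) (I1 I2 : interval R) (L1 L2 : {scalar {poly R}}).
Variables (kappa theta : {poly R}).
Hypothesis sys : pearson_system I1 I2 L1 L2 kappa theta.

Let kappa_neq0 : kappa != 0.
Proof.
by apply: contraTneq (pearson_kappa0 sys) => ->; rewrite horner0 ltxx.
Qed.

Lemma angelesco_system1 : angelesco_system I1 I2 L1 L2 1.
Proof.
case: sys => ng ps d1 d2 *; split=> //; last exact: oner_neq0.
- by left=> x _; rewrite hornerC.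
- by left=> x _; rewrite hornerC.
Qed.

Lemma angelesco_systemX : angelesco_system I1 I2 L1 L2 'X.
Proof.
case: sys => ng ps d1 d2 *; split=> //; last by rewrite polyX_eq0.
- by right=> x /ng; rewrite hornerX.
- by left=> x /ps; rewrite hornerX.
Qed.

Lemma angelesco_system_kappa : angelesco_system I1 I2 L1 L2 kappa.
Proof. by case: sys => ng ps d1 d2 k1 k2 *; split=> //; left. Qed.

Lemma angelesco_systemX_kappa : angelesco_system I1 I2 L1 L2 ('X * kappa).
Proof.
case: sys => ng ps d1 d2 k1 k2 *; split=> //; last by rewrite mulf_neq0 ?polyX_eq0.
- by right=> x xI; rewrite hornerM hornerX pmulr_llt0; [exact: ng|exact: k1].
- by left=> x xI; rewrite hornerM hornerX pmulr_lgt0; [exact: ps|exact: k2].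
Qed.

Let c_lt0 : (lead_coef theta)^-1 < 0.
Proof. by rewrite invr_lt0; case: sys. Qed.

Section Zeros.
Variables (q : {poly R}) (m : nat).
Hypothesis orthq : multiple_orthogonal L1 L2 ('X * kappa) m q.

Let raised_orthogonal (u v : {poly R}) n : (size v <= 2)%N ->
  orthogonal_below L1 m.+1 (u * (pearson_operator kappa theta q + (v * q) *+ n)) ->
  orthogonal_below L2 m.+1 (u * (pearson_operator kappa theta q + (v * q) *+ n)) ->
  multiple_orthogonal L1 L2 u m.+1 (raised kappa theta v q n).
Proof.
move=> sv o1 o2; case: sys => _ _ _ _ _ _ _ sk st _ _ _ _; case: orthq => mq sq _ _.
have [mT sT] := raised_monic n sk st sv mq sq.
by split=> // k km; rewrite /raised -!scalerAr linearZ /= ?o1 ?o2 ?mulr0.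
Qed.

Lemma raised_multiple_orthogonal1 :
  multiple_orthogonal L1 L2 1 m.+1 (raised kappa theta 0 q 0).
Proof.
case: sys => _ _ _ _ _ _ _ _ _ _ _ e1 e2; case: orthq => _ _ o1 o2.
by apply: raised_orthogonal; rewrite ?size_poly0 // mul1r mulr0n addr0;
  apply: orthogonal_pearson.
Qed.

Lemma raised_multiple_orthogonalX :
  multiple_orthogonal L1 L2 'X m.+1 (raised kappa theta kappa q m.+1).
Proof.
case: sys => _ _ _ _ _ _ _ sk _ _ _ e1 e2; case: orthq => _ _ o1 o2.
by apply: raised_orthogonal => //; apply: orthogonal_pearson_mulX.
Qed.

Lemma raised_multiple_orthogonal_kappa a : kappa = 'X - a%:P ->
  multiple_orthogonal L1 L2 kappa m.+1 (raised kappa theta 'X q m.+1).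
Proof.
move=> kE; case: sys => _ _ _ _ _ _ _ sk _ _ _ e1 e2; case: orthq => _ _ o1 o2.
by apply: raised_orthogonal; rewrite ?size_polyX //; apply: orthogonal_pearson_mulXsubC kE.
Qed.

Lemma root_poly_insert0 (s1 s2 : seq R) :
  root_poly (s1 ++ 0 :: s2) = 'X * root_poly (s1 ++ s2).
Proof.
rewrite /root_poly (perm_big (0 :: s1 ++ s2)) /= ?big_cons ?subr0 //.
by rewrite perm_catC /= perm_cons perm_catC.
Qed.

Lemma sorted_insert0 n p s1 s2 : zeros_split I1 I2 n p s1 s2 ->
  sorted <%R (s1 ++ 0 :: s2).
Proof.
case=> ss [sI1 sI2] _ _ _; move: ss.
rewrite !sorted_pairwise ?pairwise_cat; try exact: lt_trans.
move=> /and3P[_ p1 p2]; rewrite p1 /= p2 andbT allrel_consr /=.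
have n1 x : x \in s1 -> x < 0 by move=> /sI1 /(pearson_neg sys).
have n2 x : x \in s2 -> 0 < x by move=> /sI2 /(pearson_pos sys).
apply/andP; split; last by apply/allP.
rewrite andbC; apply/andP; split; last by apply/allP => x /n1.
by apply/allrelP => x y /n1 x0 /n2; apply: lt_trans.
Qed.

Let raisedE (v : {poly R}) n x : root q x -> (raised kappa theta v q n).[x] =
  (lead_coef theta)^-1 * (x * kappa.[x] * (q^`()).[x]).
Proof.
move=> /rootP qx; rewrite /raised /pearson_operator.
by rewrite hornerZ !hornerD hornerMn !hornerM hornerX qx !mulr0 mul0rn !addr0.
Qed.

Section Alternation.
Variables q1 q2 : seq R.
Hypothesis zq : zeros_split I1 I2 m q q1 q2.

Let q_neq0 x : x \in q1 ++ q2 -> [/\ root q x, x != 0 & 0 < kappa.[x]].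
Proof.
move=> xq; have rx : root q x.
  by case: zq => _ _ -> _ _; rewrite /root_poly root_prod_XsubC.
case: zq => _ [s1 s2] _ _ _; case: sys => ng ps _ _ k1 k2 *; split=> //.
  move: xq; rewrite mem_cat => /orP[/s1/ng|/s2/ps] x0; first by rewrite lt_eqF.
  by rewrite gt_eqF.
by move: xq; rewrite mem_cat => /orP[/s1/k1|/s2/k2].
Qed.

Let sorted_q0 : sorted <%R (q1 ++ 0 :: q2).
Proof. exact: sorted_insert0 zq. Qed.

Let Xq : root_poly (q1 ++ 0 :: q2) = 'X * q.
Proof. by case: zq => _ _ -> _ _; rewrite root_poly_insert0. Qed.

Let q0_neq0 : q.[0] != 0.
Proof.
case: zq => _ [s1 s2] -> _ _; rewrite -/(root _ _) root_prod_XsubC mem_cat negb_or.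
by apply/andP; split; apply/negP; [move/s1/(pearson_neg sys)|move/s2/(pearson_pos sys)];
  rewrite ltxx.
Qed.

(** This treats [P], [S] and [T] at once: the term in [v] vanishes at the zeros of [q], and at 0 it
    enters only through [v.[0]], which is 0 for [P] and [T] and [kappa.[0]] for [S]. *)
Lemma interleaved_raised (v : {poly R}) n s1 s2 : 0 <= v.[0] ->
  zeros_split I1 I2 m.+1 (raised kappa theta v q n) s1 s2 ->
  interleaved (s1 ++ s2) (q1 ++ 0 :: q2).
Proof.
move=> v0 [ss _ TE z1 z2]; case: (zq) => _ _ _ w1 w2.
apply: interleaved_of_deriv => //.
  by rewrite !size_cat /= z1 z2 w1 w2 addSn.
move=> y; rewrite -TE Xq derivM derivX mul1r hornerD hornerM hornerX.
have [->|yn0] := eqVneq y 0; last first.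
  rewrite mem_cat inE (negbTE yn0) /= -mem_cat => yq; have [ry _ ky] := q_neq0 yq.
  rewrite raisedE // (rootP ry) add0r.
  have dq : q^`().[y] != 0.
    case: (zq) => sq _ -> _ _; apply: deriv_root_poly_neq0 => //.
    by move: sq; rewrite lt_sorted_uniq_le => /andP[].
  (* The product is rearranged into the negative constant [c] times a positive factor times a
     square. *)
  have E (c k d : R) : c * (y * k * d) * (y * d) = c * (k * (y * d) ^+ 2) by ring.
  rewrite E.
  by rewrite nmulr_rlt0 // pmulr_rgt0 // exprn_even_gt0 // mulf_neq0.
rewrite mul0r addr0 => _; rewrite /raised /pearson_operator.
rewrite hornerZ !hornerD hornerMn !hornerM hornerX !mul0r add0r.
have E (c t v0' q0 : R) : c * (t * q0 + v0' * q0 *+ n) * q0 =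
    c * ((t + v0' *+ n) * q0 ^+ 2) by ring.
rewrite E.
rewrite nmulr_rlt0 // pmulr_rgt0 ?exprn_even_gt0 //.
by rewrite ltr_wpDr ?mulrn_wge0 ?(pearson_theta0 sys).
Qed.

Variables p1 p2 : seq R.
Hypothesis zp : zeros_split I1 I2 m.+1 (raised kappa theta 0 q 0) p1 p2.

(** At a zero of [P] the Pearson term vanishes, so only the added multiple of [v q] survives. This
    turns the products to be signed into negative multiples of squares. *)
Let raised_at_zero (v : {poly R}) n x : x \in p1 ++ p2 -> (raised kappa theta v q n).[x] =
  (lead_coef theta)^-1 * (v.[x] * q.[x] *+ n).
Proof.
move=> xp; have : (raised kappa theta 0 q 0).[x] = 0.
  by apply/rootP; case: zp => _ _ -> _ _; rewrite /root_poly root_prod_XsubC.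
rewrite /raised; move: (pearson_operator _ _ _) => A.
rewrite !hornerZ mulr0n addr0 hornerD mulrDr => ->.
by rewrite add0r hornerMn hornerM.
Qed.

(** If [q] vanished at a zero of [P], then [P] would reduce there to a multiple of [x kappa q'],
    which is nonzero because the zeros of [q] are simple. *)
Let p_neq0 x : x \in p1 ++ p2 -> [/\ q.[x] != 0, x != 0 & 0 < kappa.[x]].
Proof.
move=> xp; have [x0 kx] : x != 0 /\ 0 < kappa.[x].
  case: zp => _ [s1 s2] _ _ _; case: sys => ng ps _ _ k1 k2 *; split.
    move: xp; rewrite mem_cat => /orP[/s1/ng|/s2/ps] x0; first by rewrite lt_eqF.
    by rewrite gt_eqF.
  by move: xp; rewrite mem_cat => /orP[/s1/k1|/s2/k2].
split=> //; apply/negP => qx.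
have /rootP : root (raised kappa theta 0 q 0) x.
  by case: zp => _ _ -> _ _; rewrite /root_poly root_prod_XsubC.
rewrite raisedE //; apply/eqP; apply: mulf_neq0; first by rewrite lt_eqF.
apply: mulf_neq0; first by rewrite mulf_neq0 // gt_eqF.
case: (zq) => sq _ qE _ _; rewrite qE; apply: deriv_root_poly_neq0 => //.
  by move: sq; rewrite lt_sorted_uniq_le => /andP[].
by move: qx; rewrite qE -/(root _ _) root_prod_XsubC.
Qed.

Let size_p : size (p1 ++ p2) = (size (q1 ++ 0 :: q2)).+1.
Proof. by case: zp zq => _ _ _ z1 z2 [_ _ _ w1 w2]; rewrite !size_cat /= z1 z2 w1 w2 addSn. Qed.

Let interleaved_pq : interleaved (p1 ++ p2) (q1 ++ 0 :: q2).
Proof. by apply: interleaved_raised zp; rewrite horner0. Qed.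

Lemma interleaved_raisedX r1 r2 :
  zeros_split I1 I2 m.+1 (raised kappa theta 'X q m.+1) r1 r2 ->
  interleaved (p1 ++ p2) (r1 ++ r2).
Proof.
move=> [sr _ rE z1 z2]; case: (zp) => sp _ _ w1 w2.
apply: interleaved_of_sign sp sorted_q0 sr size_p interleaved_pq _ _.
  by rewrite !size_cat z1 z2 w1 w2.
move=> y yp; have [qy y0 ky] := p_neq0 yp.
rewrite -rE Xq raised_at_zero // hornerM hornerX.
have E (c d : R) : c * (y * d *+ m.+1) * (y * d) = c * ((y * d) ^+ 2 *+ m.+1) by ring.
rewrite E.
by rewrite nmulr_rlt0 // pmulrn_lgt0 // exprn_even_gt0 // mulf_neq0.
Qed.

(** At a zero [y] of [P] the product of [S] with [x q] has a sign depending on that of [y]. Passing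
    to [x S], that is, inserting 0 between the two blocks, replaces the factor [y] by [y^2]. *)
Lemma interleaved_raised_kappa s1 s2 :
  zeros_split I1 I2 m.+1 (raised kappa theta kappa q m.+1) s1 s2 ->
  interleaved (s1 ++ 0 :: s2) (p1 ++ p2).
Proof.
move=> zs; have ss0 := sorted_insert0 zs.
case: zs => _ _ sE z1 z2; case: (zp) => sp _ _ w1 w2.
apply: interleaved_of_signS sp sorted_q0 ss0 size_p interleaved_pq _ _.
  by rewrite !size_cat /= z1 z2 w1 w2 addnS.
move=> y yp; have [qy y0 ky] := p_neq0 yp.
rewrite root_poly_insert0 -sE Xq hornerM hornerX raised_at_zero // hornerM hornerX.
have E (c k d : R) : y * (c * (k * d *+ m.+1)) * (y * d) = c * ((k * (y * d) ^+ 2) *+ m.+1) by ring.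
rewrite E.
by rewrite nmulr_rlt0 // pmulrn_lgt0 // pmulr_rgt0 // exprn_even_gt0 // mulf_neq0.
Qed.

End Alternation.
End Zeros.
End PearsonInterlacing.

(** * Integrals against the weights *)

Section Integrals.
Local Open Scope classical_set_scope.
Local Open Scope ring_scope.

(** * Integrals over an open set exhausted by compact segments *)

Section Exhaustion.
Variables (R : realType) (D : set R) (u v : R^nat).
Hypotheses (oD : open D) (uv : forall n, u n < v n).
Hypothesis nd : nondecreasing_seq (fun n => `[u n, v n]%classic).
Hypothesis cov : D = \bigcup_n `[u n, v n]%classic.
Let mu := @lebesgue_measure R.
Let mD : measurable D. Proof. exact: open_measurable. Qed.

Let segD n : `[u n, v n]%classic `<=` D.
Proof. by rewrite cov => x xn; exists n. Qed.

Lemma integral_segment_primitive (F f : R -> R) n :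
  (forall x, D x -> is_derive x 1 F (f x)) -> {in D, continuous f} ->
  (\int[mu]_(x in `[u n, v n]) (f x)%:E = (F (v n))%:E - (F (u n))%:E)%E.
Proof.
move=> dF cf.
have cF x : D x -> {for x, continuous F}.
  by move=> /dF [dFx _]; apply/differentiable_continuous; rewrite -derivable1_diffP.
have [Du Dv] : D (u n) /\ D (v n).
  by split; apply: (@segD n); rewrite /= in_itv /= lexx (ltW (uv n)).
apply: continuous_FTC2 => //.
- by apply/continuous_in_subspaceT => x /set_mem /segD xD; apply: cf; rewrite inE.
- split.
  + by move=> x xn; have [] := dF x (segD (subset_itv_oo_cc xn)).
  + by apply: cvg_at_right_filter; exact: cF.
  + by apply: cvg_at_left_filter; exact: cF.
- move=> x xn; rewrite derive1E.
  by have [_ ->] := dF x (segD (subset_itv_oo_cc xn)).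
Qed.

(** The integral over each segment is a difference of two values of [H], hence at most [2 * M], and
    monotone convergence carries this bound over to [D]. *)
Lemma integrable_of_bounded_primitive (H h : R -> R) M :
  (forall x, D x -> is_derive x 1 H (h x)) -> {in D, continuous h} ->
  (forall x, D x -> 0 <= h x) -> (forall x, D x -> `|H x| <= M) ->
  mu.-integrable D (EFin \o h).
Proof.
move=> dH ch h0 HM; have mh : measurable_fun D h by exact: open_continuous_measurable_fun.
apply/integrableP; split; first exact/measurable_EFinP.
have -> : (\int[mu]_(x in D) `|(EFin \o h) x| = \int[mu]_(x in D) (h x)%:E)%E.
  by apply: eq_integral => x /set_mem xD; rewrite /= ger0_norm ?h0.
have cv : (\int[mu]_(x in `[u n, v n]) (h x)%:E @[n --> \oo] --> \int[mu]_(x in D) (h x)%:E)%E.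
  rewrite cov; apply: ge0_nondecreasing_set_cvg_integral => //.
  - by move=> i; apply/measurable_EFinP; exact: measurable_funS mh.
  - by move=> i x xi; rewrite lee_fin h0 //; exact: segD xi.
apply: (@le_lt_trans _ _ (2 * M)%:E); last exact: ltry.
apply: cvge_le cv; apply: nearW => n.
rewrite (integral_segment_primitive n dH ch) -EFinB lee_fin.
have [Du Dv] : D (u n) /\ D (v n).
  by split; apply: (@segD n); rewrite /= in_itv /= lexx (ltW (uv n)).
by move: (HM _ Du) (HM _ Dv); rewrite !ler_norml => /andP[? ?] /andP[? ?]; lra.
Qed.

(** Over the segments the integrals are [G (v n) - G (u n)], which tends to 0; dominated convergence
    with majorant [h] identifies their limit with the integral over [D]. *)
Lemma integral_derivative_eq0 (G g h : R -> R) :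
  (forall x, D x -> is_derive x 1 G (g x)) -> {in D, continuous g} ->
  mu.-integrable D (EFin \o h) -> (forall x, D x -> `|g x| <= h x) ->
  G (u n) @[n --> \oo] --> 0 -> G (v n) @[n --> \oo] --> 0 ->
  (\int[mu]_(x in D) (g x)%:E = 0)%E.
Proof.
move=> dG cg ih gh Gu Gv.
have mg : measurable_fun D g by exact: open_continuous_measurable_fun.
pose f_ n x := (((g \_ `[u n, v n]) x)%:E : \bar R).
have [||||| _ _] := @dominated_convergence _ _ _ mu D mD f_ (EFin \o g) (EFin \o h).
- move=> n; apply/measurable_EFinP; apply/measurable_restrict => //.
  by apply: measurable_funS mg => // x [].
- exact/measurable_EFinP.
- apply/aeW => x; rewrite {1}cov => -[N _ xN]; apply: cvg_near_cst.
  near=> n; rewrite /f_ patchE mem_set //.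
  have : `[u N, v N]%classic `<=` `[u n, v n].
    by rewrite -subsetEset; apply: nd; near: n; exact: nbhs_infty_ge.
  exact.
- exact: ih.
- apply/aeW => x n xD; rewrite /f_ patchE; case: ifPn => _; rewrite /= lee_fin ?gh //.
  by rewrite normr0 (le_trans _ (gh _ xD)).
have -> : [sequence (\int[mu]_(x in D) f_ n x)%E]_n = (fun n => (G (v n) - G (u n))%:E).
  apply/funext => n /=; rewrite EFinB -(integral_segment_primitive n dG cg).
  rewrite -(setIidr (@segD n)) integral_mkcondr.
  by apply: eq_integral => x _; rewrite /f_ restrict_EFin.
move=> cv; have : (G (v n) - G (u n))%:E @[n --> \oo] --> (0 - 0)%:E.
  by apply: cvg_EFin; [exact: nearW|exact: cvgB].
by rewrite subrr => /(cvg_unique _ cv) ->.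
Unshelve. all: by end_near. Qed.

End Exhaustion.

(** * Weights as linear forms on polynomials *)

Lemma integral_form (R : realType) (D : set R) (w : R -> R) : measurable D ->
  (forall p : {poly R},
     (@lebesgue_measure R).-integrable D (fun x => (p.[x] * w x)%:E)) ->
  exists L : {scalar {poly R}}, forall p : {poly R},
    (\int[@lebesgue_measure R]_(x in D) (p.[x] * w x)%:E = (L p)%:E)%E.
Proof.
move=> mD iw.
pose L0 (p : {poly R}) := (\int[@lebesgue_measure R]_(x in D) (p.[x] * w x))%R.
have L0E p : (\int[@lebesgue_measure R]_(x in D) (p.[x] * w x)%:E = (L0 p)%:E)%E.
  by rewrite /L0 /Rintegral fineK //; exact: integrable_fin_num.
have lin : scalar L0.
  move=> c p q; apply: EFin_inj; rewrite EFinD EFinM -!L0E -integralZl // -integralD //.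
    by apply: eq_integral => x _; rewrite -EFinM -EFinD hornerD hornerZ mulrDl mulrA.
  exact: integrableZl.
pose L : {scalar {poly R}} := HB.pack L0 (GRing.isLinear.Build _ _ _ _ L0 lin).
by exists L.
Qed.

Lemma roots_in_seq (F : fieldType) (p : {poly F}) : p != 0 ->
  exists s : seq F, forall x, root p x -> x \in s.
Proof.
have [m] := ubnP (size p); elim: m p => // m IH p sp p0.
have [[z rz]|nr] := pselect (exists z, root p z); last first.
  by exists [::] => x rx; case: nr; exists x.
move/factor_theorem: rz => [q pE].
have q0 : q != 0 by apply: contraNneq p0 => q0; rewrite pE q0 mul0r.
have [|s sP] := IH q _ q0.
  by move: sp; rewrite pE size_Mmonic ?monicXsubC // size_XsubC addn2.
by exists (z :: s) => x; rewrite pE rootM root_XsubC inE orbC => /orP[->//|/sP ->]; rewrite orbT.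
Qed.

(** A nonnegative integrand with zero integral vanishes almost everywhere. As [w] is positive, [I]
    would be contained in the union of a null set and the finitely many roots of [p], against its
    positive measure. *)
Lemma definite_form (R : realType) (I : interval R) (w : R -> R) (L : {poly R} -> R) :
  (0 < @lebesgue_measure R [set` I])%E ->
  (forall x, x \in I -> 0 < w x) ->
  (forall p : {poly R},
     (@lebesgue_measure R).-integrable [set` I] (fun x => (p.[x] * w x)%:E)) ->
  (forall p : {poly R},
    (\int[@lebesgue_measure R]_(x in [set` I]) (p.[x] * w x)%:E = (L p)%:E)%E) ->
  definite_on I L.
Proof.
move=> I0 w0 iw LE p p0 pI; apply/eqP => Lp0.
have mI : measurable [set` I] by exact: measurable_itv.
have mf := measurable_int _ (iw p).
have : (\int[@lebesgue_measure R]_(x in [set` I]) `|(p.[x] * w x)%:E| = 0)%E.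
  rewrite -[RHS]/(0%:E) -Lp0 -LE; apply: eq_integral => x /set_mem /= xI.
  by rewrite ger0_norm // mulr_ge0 ?pI // ltW // w0.
move/(ae_eq_integral_abs (@lebesgue_measure R) mI mf) => [N [mN N0 IN]].
have [s sP] := roots_in_seq p0.
have s0 : (@lebesgue_measure R [set` s] = 0)%E.
  by apply: countable_lebesgue_measure0; exact/finite_set_countable/finite_seq.
have mS : measurable [set` s].
  by apply: countable_measurable => [t|];
    [exact: measurable_set1|exact/finite_set_countable/finite_seq].
suff : (@lebesgue_measure R [set` I] <= 0)%E by rewrite leNgt I0.
rewrite -[leRHS]adde0 -{1}N0 -s0; apply: le_trans (measureU2 _ mN mS).
apply: le_measure; rewrite ?inE //; first exact: measurableU.
move=> x xI; have [xs|xs] := boolP (x \in s); first by right.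
left; apply: IN => /= /(_ xI) [] /eqP; rewrite mulf_eq0 => /orP[px|].
  by move: xs; rewrite sP.
by rewrite (gt_eqF (w0 _ xI)).
Qed.

(* The majorant [h] is integrable because its primitive [H] is bounded. *)
Lemma weighted_form (R : realType) (I : interval R) (u v : R^nat) (w w' H h : R -> R)
    (kappa theta : {poly R}) (M : R) :
  open [set` I] -> (forall n, u n < v n) ->
  nondecreasing_seq (fun n => `[u n, v n]%classic) ->
  [set` I] = \bigcup_n `[u n, v n]%classic ->
  (0 < @lebesgue_measure R [set` I])%E ->
  {in I, forall x, 0 < w x} ->
  {in I, forall x : R, is_derive x 1 w (w' x)} ->
  {in I, forall x, x * kappa.[x] * w' x = (theta - ('X * kappa)^`()).[x] * w x} ->
  {in I, forall x : R, is_derive x 1 H (h x)} -> {in I, continuous h} ->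
  {in I, forall x, 0 <= h x} -> {in I, forall x, `|H x| <= M} ->
  (forall p : {poly R}, exists C, {in I, forall x, `|p.[x]| * w x <= C * h x}) ->
  (forall p : {poly R}, p.[u n] * (u n * kappa.[u n] * w (u n)) @[n --> \oo] --> 0) ->
  (forall p : {poly R}, p.[v n] * (v n * kappa.[v n] * w (v n)) @[n --> \oo] --> 0) ->
  exists L : {scalar {poly R}},
    [/\ forall p : {poly R},
          (\int[@lebesgue_measure R]_(x in [set` I]) (p.[x] * w x)%:E = (L p)%:E)%E,
        definite_on I L & pearson L kappa theta].
Proof.
move=> oI uv nd cov I0 w0 dw wE dH ch h0 HM bd limu limv.
have mI : measurable [set` I] by exact: measurable_itv.
have cw x : x \in I -> {for x, continuous w}.
  by move=> /dw [dwx _]; apply/differentiable_continuous; rewrite -derivable1_diffP.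
have cpw (p : {poly R}) : {in [set` I], continuous (fun x => p.[x] * w x)}.
  by move=> x /set_mem xI; apply: cvgM; [exact: continuous_horner|exact: cw].
have ih : (@lebesgue_measure R).-integrable [set` I] (EFin \o h).
  apply: (integrable_of_bounded_primitive oI uv nd cov (H := H) (M := M)) => //.
  by move=> x /set_mem; exact: ch.
have bdn p : exists C, {in I, forall x, `|p.[x] * w x| <= C * h x}.
  have [C Ch] := bd p; exists C => x xI.
  by rewrite normrM (gtr0_norm (w0 _ xI)) Ch.
have ihC C : (@lebesgue_measure R).-integrable [set` I] (EFin \o (fun x => C * h x)).
  rewrite (_ : _ \o _ = fun x => (C%:E * (EFin \o h) x)%E); first exact: integrableZl.
  by apply/funext => x /=; rewrite EFinM.
have iw p : (@lebesgue_measure R).-integrable [set` I] (fun x => (p.[x] * w x)%:E).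
  have [C Ch] := bdn p; apply: le_integrable (ihC C) => //.
    by apply/measurable_EFinP; exact: open_continuous_measurable_fun.
  move=> x xI /=; rewrite lee_fin; apply: le_trans (Ch _ xI) _; exact: ler_norm.
have [L LE] := integral_form mI iw.
exists L; split=> //; first exact: definite_form I0 w0 iw LE.
move=> p; apply: EFin_inj; rewrite -LE; have [C Ch] := bdn (pearson_operator kappa theta p).
apply: (@integral_derivative_eq0 _ _ u v oI uv nd cov
  (fun x => p.[x] * (x * kappa.[x] * w x)) _ (fun x => C * h x)) => //.
move=> x xI; have dwx := dw x xI.
have -> : (fun x => p.[x] * (x * kappa.[x] * w x)) = horner p * (horner ('X * kappa) * w).
  by apply/funext => y /=; rewrite !fctE hornerM hornerX.
apply: is_derive_eq.
rewrite !fctE /pearson_operator /GRing.scale /=.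
have := wE x xI; rewrite hornerD hornerN !hornerE => ->; ring.
Qed.

(** * Growth estimates *)

Lemma powR_antitone (R : realType) (s l z : R) : s <= 0 -> 0 < l -> l <= z -> z `^ s <= l `^ s.
Proof.
move=> s0 l0 lz; have z0 := lt_le_trans l0 lz.
rewrite -[s]opprK (powRN z) (powRN l) lef_pV2 ?posrE ?powR_gt0 //.
by apply: ge0_ler_powR; rewrite ?oppr_ge0 // nnegrE ltW.
Qed.

(** The power is monotone, in a direction that depends on the sign of [s]; the sum of the two end
    values bounds it in both cases. *)
Lemma powR_le_ends (R : realType) (s l r z : R) : 0 < l -> l <= z -> z <= r ->
  z `^ s <= l `^ s + r `^ s.
Proof.
move=> l0 lz zr; have z0 := lt_le_trans l0 lz; have r0 := lt_le_trans z0 zr.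
have [s0|/ltW s0] := leP 0 s.
  by rewrite ler_wpDl ?powR_ge0 // ge0_ler_powR // nnegrE ltW.
by rewrite ler_wpDr ?powR_ge0 // powR_antitone.
Qed.

Lemma horner_growth (R : realType) (p : {poly R}) :
  exists C k, 0 <= C /\ forall x : R, `|p.[x]| <= C * (1 + `|x|) ^+ k.
Proof.
elim/poly_ind: p => [|p c [C [k [C0 IH]]]].
  by exists 0, 0%N; split=> // x; rewrite horner0 normr0 mul0r.
exists (C + `|c|), k.+1; split=> [|x]; first by rewrite addr_ge0.
have x1 : 1 <= 1 + `|x| by rewrite lerDl.
rewrite hornerMXaddC mulrDl; apply: le_trans (ler_normD _ _) _; apply: lerD.
  rewrite normrM exprSr mulrA; apply: ler_pM; rewrite ?IH //.
  by rewrite lerDr.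
by rewrite ler_peMr // exprn_ege1.
Qed.

Lemma powR_growth (R : realType) (c s : R) : 0 < c ->
  exists C k, 0 <= C /\ forall x : R, 0 <= x -> (x + c) `^ s <= C * (1 + x) ^+ k.
Proof.
move=> c0; have [s0|/ltW s0] := leP s 0.
  exists (c `^ s), 0%N; split=> [|x x0]; first exact: powR_ge0.
  by rewrite expr0 mulr1 powR_antitone // lerDr.
pose k := (Num.truncn s).+1; have sk : s <= k%:R by apply/ltW/truncnS_gt.
exists ((1 + c) ^+ k), k; split=> [|x x0]; first by rewrite exprn_ge0 // addr_ge0 // ltW.
rewrite -exprMn; have b1 : 1 <= (1 + c) * (1 + x).
  by rewrite -[leLHS]mulr1 ler_pM ?lerDl // ltW.
have b0 : 0 <= (1 + c) * (1 + x) by apply: le_trans b1.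
rewrite -powR_mulrn //; apply: le_trans (ler_powR b1 sk).
by apply: ge0_ler_powR; rewrite ?nnegrE ?addr_ge0 //; [exact: ltW| nra].
Qed.

Lemma expr_le_expR (R : realType) k :
  exists C, 0 <= C /\ forall x : R, 0 <= x -> (1 + x) ^+ k <= C * expR x.
Proof.
(* A single term of the exponential series at [1 + x] gives [(1 + x)^(k+1) <= (k+1)! e^(1+x)]; the
   factor [expR 1] comes from the shift of the argument. *)
exists (k.+1`!%:R * expR 1); split=> [|x x0]; first by rewrite mulr_ge0 ?expR_ge0.
rewrite -mulrA -expRD; have y1 : 1 <= 1 + x by rewrite lerDl.
have := expR_ge1Dxn k (le_trans ler01 y1).
move=> /(le_trans _) e; apply: (@le_trans _ _ ((1 + x) ^+ k.+1)).
  by rewrite exprS ler_peMl // exprn_ge0 // (le_trans ler01).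
rewrite mulrC -ler_pdivrMr ?ltr0n ?fact_gt0 //.
by apply: e; rewrite lerDr.
Qed.

Lemma cvg0_le (R : realType) (f g : R^nat) (C : R) :
  (forall n, `|f n| <= C * g n) -> g n @[n --> \oo] --> 0 -> f n @[n --> \oo] --> 0.
Proof.
move=> fg g0; apply/norm_cvg0P; apply: (@squeeze_cvgr _ _ _ _ (cst 0) (fun n => C * g n)).
- by apply: nearW => n /=; rewrite normr_ge0 fg.
- exact: cvg_cst.
- by rewrite -[X in _ --> X](mulr0 C); apply: cvgM; [exact: cvg_cst|].
Qed.

Lemma nondecreasing_segments (R : realType) (u v : R^nat) :
  {homo u : m n / (m <= n)%N >-> n <= m} -> {homo v : m n / (m <= n)%N >-> m <= n} ->
  nondecreasing_seq (fun n => `[u n, v n]%classic).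
Proof.
move=> du iv m n mn; rewrite subsetEset => x /=; rewrite !in_itv /= => /andP[ux xv].
by rewrite (le_trans (du _ _ mn)) //= (le_trans xv) // iv.
Qed.

Lemma is_derive_1D (R : realType) (x : R) : is_derive x 1 (fun y : R => 1 + y) 1.
Proof.
rewrite [X in is_derive _ _ X _](_ : _ = cst 1 + id) //.
by apply: is_derive_eq; rewrite add0r.
Qed.

(* The derivative of the bounded function [(x / (1 + x))^(g + 1)]: an integrable
   majorant with the behaviour of [x^g] at [0]. *)
Definition half_line_density (R : realType) (g x : R) :=
  (g + 1) * (x `^ g * (1 + x) `^ (- (g + 2))).

Section HalfLine.
Variables (R : realType) (g : R).
Hypothesis g1 : -1 < g.
Let g1p : 0 < g + 1. Proof. by rewrite -ltrBlDr sub0r. Qed.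
Let H (x : R) := x `^ (g + 1) * (1 + x) `^ (- (g + 1)).
Let h := half_line_density g.

Let HE (x : R) : 0 < x -> H x = x * (1 + x) * (x `^ g * (1 + x) `^ (- (g + 2))).
Proof.
move=> x0; have x1 : 0 < 1 + x by rewrite addr_gt0.
rewrite /H powRD ?(gt_eqF x0) ?implybT // powRr1 ?ltW //.
rewrite (_ : - (g + 1) = - (g + 2) + 1); last by ring.
by rewrite powRD ?(gt_eqF x1) ?implybT // powRr1 ?ltW //; ring.
Qed.

Let dH (x : R) : 0 < x -> is_derive x 1 H (h x).
Proof.
move=> x0; have x1 : 0 < 1 + x by rewrite addr_gt0.
have d1 := is_derive_1D x.
have -> : H = (fun y => y `^ (g + 1)) * ((fun y => y `^ (- (g + 1))) \o (fun y => 1 + y)) by [].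
apply: is_derive_eq.
  apply: is_deriveM; first exact: is_derive1_powR.
  by apply: is_derive1_comp; exact: is_derive1_powR.
rewrite /GRing.scale /= /h /half_line_density.
rewrite (_ : - (g + 1) - 1 = - (g + 2)); last by ring.
rewrite (_ : - (g + 1) = - (g + 2) + 1); last by ring.
rewrite (_ : g + 1 - 1 = g); last by ring.
rewrite !powRD ?(gt_eqF x1) ?(gt_eqF x0) ?implybT //.
by rewrite !powRr1 ?ltW //; ring.
Qed.

Let ch (x : R) : 0 < x -> {for x, continuous h}.
Proof.
move=> x0; have x1 : 0 < 1 + x by rewrite addr_gt0.
have d1 := is_derive_1D x.
apply: differentiable_continuous; rewrite -derivable1_diffP.
have -> : h = cst (g + 1) *
    ((fun y => y `^ g) * ((fun y => y `^ (- (g + 2))) \o (fun y => 1 + y))) by [].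
apply: derivableM => //; apply: derivableM.
  by have [] := is_derive1_powR g x0.
by have [] := is_derive1_comp (is_derive1_powR (- (g + 2)) x1) d1.
Qed.

Let h_gt0 (x : R) : 0 < x -> 0 < h x.
Proof.
move=> x0; have x1 : 0 < 1 + x by rewrite addr_gt0.
by rewrite /h /half_line_density !mulr_gt0 ?powR_gt0.
Qed.

Let H_le1 (x : R) : 0 < x -> `|H x| <= 1.
Proof.
move=> x0; have x1 : 0 < 1 + x by rewrite addr_gt0.
rewrite ger0_norm /H ?mulr_ge0 ?powR_ge0 // powRN.
rewrite ler_pdivrMr ?powR_gt0 // mul1r.
apply: ge0_ler_powR; rewrite ?nnegrE ?ltW //.
by rewrite ltrDr.
Qed.

(** Dividing by [x^g (1 + x)^(-(g+2))] removes the singularity at 0 and leaves a function of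
    polynomial growth times [e^(-x)]. The shifted power stands for [(x - a)^beta] with [c = - a]; in
    the Laguerre-Hermite case it is switched off by [s = 0]. *)
Lemma half_line_density_bound c s (p : {poly R}) : 0 < c ->
  exists C, forall x : R, 0 < x ->
    `|p.[x]| * ((x + c) `^ s * x `^ g * expR (- x)) <= C * half_line_density g x.
Proof.
move=> c0; have [C1 [k1 [C10 b1]]] := horner_growth p.
have [C2 [k2 [C20 b2]]] := powR_growth s c0.
have [C3 [k3 [C30 b3]]] := powR_growth (g + 2) (@ltr01 R).
have [C4 [C40 b4]] := expr_le_expR R (k1 + (k2 + k3)).
exists (C1 * (C2 * C3) * C4 / (g + 1)) => x x0.
have x1 : 0 < 1 + x by rewrite addr_gt0.
have e0 := expR_gt0 x.
have -> : C1 * (C2 * C3) * C4 / (g + 1) * half_line_density g x =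
   C1 * (C2 * C3) * (C4 * expR x) * (x `^ g * (1 + x) `^ (- (g + 2)) * expR (- x)).
  rewrite /half_line_density expRN; field; first by rewrite !gt_eqF.
have -> : `|p.[x]| * ((x + c) `^ s * x `^ g * expR (- x)) =
    `|p.[x]| * ((x + c) `^ s * (x + 1) `^ (g + 2)) *
    (x `^ g * (1 + x) `^ (- (g + 2)) * expR (- x)).
  rewrite powRN [x + 1]addrC; field.
  by rewrite gt_eqF // powR_gt0.
apply: ler_wpM2r; first by rewrite !mulr_ge0 ?powR_ge0 ?expR_ge0.
apply: (@le_trans _ _ (C1 * (C2 * C3) * (1 + x) ^+ (k1 + (k2 + k3)))); last first.
  by apply: ler_wpM2l; [rewrite !mulr_ge0|rewrite b4 ?ltW].
rewrite !exprD; have -> : C1 * (C2 * C3) * ((1 + x) ^+ k1 * ((1 + x) ^+ k2 * (1 + x) ^+ k3)) =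
    C1 * (1 + x) ^+ k1 * (C2 * (1 + x) ^+ k2 * (C3 * (1 + x) ^+ k3)).
  by rewrite [LHS]mulrACA; congr (_ * _); rewrite mulrACA.
have := b1 x; rewrite (gtr0_norm x0) => b1x.
apply: ler_pM => //; first by rewrite mulr_ge0 ?powR_ge0.
by apply: ler_pM; rewrite ?powR_ge0 ?b2 ?b3 ?ltW.
Qed.

(** The offset 2 makes [1 / (n + 2) < n + 2] strict already at [n = 0], where an offset of 1 would
    give equality. *)
Let a_ (n : nat) : R := n.+2%:R.
Let b_ (n : nat) : R := (n.+2%:R)^-1.
Let a_gt0 n : 0 < a_ n. Proof. by rewrite ltr0n. Qed.
Let b_gt0 n : 0 < b_ n. Proof. by rewrite invr_gt0. Qed.
Let a_homo : {homo a_ : m n / (m <= n)%N >-> m <= n}.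
Proof. by move=> m n mn; rewrite ler_nat. Qed.
Let b_homo : {homo b_ : m n / (m <= n)%N >-> n <= m}.
Proof. by move=> m n mn; rewrite lef_pV2 ?posrE ?a_gt0 // a_homo. Qed.
Let ba n : b_ n < a_ n.
Proof.
have a1 : 1 < a_ n by rewrite ltr1n.
by apply: lt_trans (a1); rewrite /b_ invf_lt1 ?ltr0n.
Qed.
Let ab_cover (x : R) : 0 < x -> exists n, b_ n <= x <= a_ n.
Proof.
move=> x0; exists (Num.truncn x + Num.truncn x^-1)%N; apply/andP; split.
- rewrite -[leRHS]invrK lef_pV2 ?posrE ?invr_gt0 // ?a_gt0 //.
  by apply: le_trans (ltW (truncnS_gt _)) _; rewrite ler_nat ltnS leqW // leq_addl.
- by apply: le_trans (ltW (truncnS_gt _)) _; rewrite ler_nat ltnS leqW // leq_addr.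
Qed.

Let b_cvg0 : b_ n @[n --> \oo] --> 0.
Proof.
apply: (@cvg0_le _ _ (@harmonic R) 1); last exact: cvg_harmonic.
move=> n; rewrite mul1r gtr0_norm // /b_ lef_pV2 ?posrE ?ltr0n //.
by rewrite ler_nat.
Qed.

Section Weight.
Variables (w w' : R -> R) (kappa theta : {poly R}).
Hypothesis w_gt0 : forall x : R, 0 < x -> 0 < w x.
Hypothesis dw : forall x : R, 0 < x -> is_derive x 1 w (w' x).
Hypothesis wE : forall x : R, 0 < x ->
  x * kappa.[x] * w' x = (theta - ('X * kappa)^`()).[x] * w x.
Hypothesis w_bound : forall p : {poly R}, exists C, forall x : R, 0 < x ->
  `|p.[x]| * w x <= C * h x.

(** The bound [w_bound] holds for every polynomial, so it can be applied to [p * kappa * (x + 1)^2].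
    The resulting majorant is independent of [p] up to a constant and serves for both ends of the
    half-line. *)
Let limit_bound (p : {poly R}) : exists C, forall x : R, 0 < x ->
  `|p.[x] * (x * kappa.[x] * w x)| <= C * (x * h x / (1 + x) ^+ 2).
Proof.
have [C Ch] := w_bound (p * kappa * ('X + 1%:P) ^+ 2).
exists C => x x0; have x1 : 0 < 1 + x by rewrite addr_gt0.
have le := Ch x x0.
rewrite hornerM horner_exp hornerM normrM normrX normrM in le.
rewrite hornerD hornerX hornerC [x + 1]addrC (gtr0_norm x1) in le.
rewrite !normrM (gtr0_norm x0) (gtr0_norm (w_gt0 x0)).
have -> : `|p.[x]| * (x * `|kappa.[x]| * w x) =
    (`|p.[x]| * `|kappa.[x]| * (1 + x) ^+ 2 * w x) * (x / (1 + x) ^+ 2).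
  by field; rewrite gt_eqF.
have -> : C * (x * h x / (1 + x) ^+ 2) = C * h x * (x / (1 + x) ^+ 2) by ring.
by apply: ler_wpM2r => //; rewrite divr_ge0 ?exprn_ge0 // ltW.
Qed.

Let limit0_bound (x : R) : 0 < x -> `|x * h x / (1 + x) ^+ 2| <= (g + 1) * x `^ (g + 1).
Proof.
move=> x0; have x1 : 0 < 1 + x by rewrite addr_gt0.
have x11 : 1 <= 1 + x by rewrite lerDl ltW.
rewrite ger0_norm; last first.
  by apply: divr_ge0; [apply: mulr_ge0; apply/ltW => //; exact: h_gt0|exact/exprn_ge0/ltW].
rewrite ler_pdivrMr ?exprn_gt0 // /h /half_line_density.
rewrite powRD ?(gt_eqF x0) ?implybT // powRr1 ?(ltW x0) //.
have -> : x * ((g + 1) * (x `^ g * (1 + x) `^ (- (g + 2)))) =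
  (g + 1) * (x `^ g * x) * (1 + x) `^ (- (g + 2)) by ring.
apply: ler_wpM2l; first by rewrite !mulr_ge0 ?powR_ge0 // ltW.
apply: (@le_trans _ _ 1); last exact: exprn_ege1.
rewrite -[leRHS](powRr0 (1 + x)); apply: ler_powR => //.
rewrite oppr_le0; apply: le_trans (ltW g1p) _; by rewrite lerD2l ler1n.
Qed.

Let limity_bound (x : R) : 0 < x -> `|x * h x / (1 + x) ^+ 2| <= (g + 1) * x^-1.
Proof.
move=> x0; have x1 : 0 < 1 + x by rewrite addr_gt0.
rewrite ger0_norm; last first.
  by apply: divr_ge0; [apply: mulr_ge0; apply/ltW => //; exact: h_gt0|exact/exprn_ge0/ltW].
have -> : x * h x / (1 + x) ^+ 2 = (g + 1) * (H x / (1 + x) ^+ 3).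
  by rewrite /h /half_line_density HE //; field; rewrite gt_eqF.
apply: ler_wpM2l; first exact: ltW.
rewrite ler_pdivrMr ?exprn_gt0 //; apply: (@le_trans _ _ 1).
  by apply: le_trans (H_le1 x0); exact: ler_norm.
rewrite ler_pdivlMl // mulr1 -[leLHS]expr1; apply: (@le_trans _ _ ((1 + x) ^+ 1)).
  by rewrite !expr1 lerDr.
by apply: ler_weXn2l => //; rewrite lerDl ltW.
Qed.

Let limit_b (p : {poly R}) :
  p.[b_ n] * (b_ n * kappa.[b_ n] * w (b_ n)) @[n --> \oo] --> 0.
Proof.
have [C Ch] := limit_bound p; apply: cvg0_le (fun n => Ch _ (b_gt0 n)) _.
apply: cvg0_le (fun n => limit0_bound (b_gt0 n)) _.
by have /cvg_at_rightP := powR_cvg0 g1p; apply; split.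
Qed.

Let limit_a (p : {poly R}) :
  p.[a_ n] * (a_ n * kappa.[a_ n] * w (a_ n)) @[n --> \oo] --> 0.
Proof.
have [C Ch] := limit_bound p; apply: cvg0_le (fun n => Ch _ (a_gt0 n)) _.
apply: cvg0_le (fun n => limity_bound (a_gt0 n)) _.
exact: b_cvg0.
Qed.

Lemma half_line_form :
  exists L : {scalar {poly R}},
    [/\ forall p : {poly R},
          (\int[@lebesgue_measure R]_(x in `]0%R, +oo[) (p.[x] * w x)%:E = (L p)%:E)%E,
        definite_on `]0, +oo[ L & pearson L kappa theta].
Proof.
have io (x : R) : x \in `]0, +oo[ -> 0 < x by rewrite in_itv /= andbT.
apply: (@weighted_form R `]0, +oo[ b_ a_ w w' H h kappa theta 1).
- exact: interval_open.
- exact: ba.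
- exact: nondecreasing_segments.
- apply/seteqP; split => x /=; rewrite in_itv /= andbT.
    by move=> /ab_cover[n xn]; exists n; rewrite //= in_itv.
  by move=> [n _]; rewrite /= in_itv /= => /andP[bx _]; exact: lt_le_trans bx.
- by rewrite lebesgue_measure_itv /= ltry ltry.
- by move=> x /io /w_gt0.
- by move=> x /io; exact: dw.
- by move=> x /io; exact: wE.
- by move=> x /io; exact: dH.
- by move=> x /io; exact: ch.
- by move=> x /io /h_gt0 /ltW.
- by move=> x /io /H_le1.
- by move=> p; have [C Ch] := w_bound p; exists C => x /io; exact: Ch.
- exact: limit_b.
- exact: limit_a.
Qed.

(** The reflection [x -> - x] carries the data over from the positive half-line. It preserves the
    equation between [w'] and [theta] because [kappa] is constant and [theta] is even; the boundary
    terms become those of [- p(- x)]. *)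
Lemma half_line_form_neg : kappa = 1 -> theta \Po (- 'X) = theta ->
  exists L : {scalar {poly R}},
    [/\ forall p : {poly R},
          (\int[@lebesgue_measure R]_(x in `]-oo, 0%R[) (p.[x] * w (- x))%:E = (L p)%:E)%E,
        definite_on `]-oo, 0[ L & pearson L kappa theta].
Proof.
move=> k1 tE; have io (x : R) : x \in `]-oo, 0[ -> 0 < - x by rewrite in_itv /= oppr_gt0.
have one_at (x : R) : (1 : {poly R}).[x] = 1 by rewrite hornerC.
have dN (f f' : R -> R) (x : R) : is_derive (- x) 1 f (f' (- x)) ->
    is_derive x 1 (fun y => f (- y)) (- f' (- x)).
  move=> df; have -> : (fun y => f (- y)) = f \o -%R by [].
  by apply: is_derive_eq; rewrite mulrN1.
apply: (@weighted_form R `]-oo, 0[ (fun n => - a_ n) (fun n => - b_ n) (fun x => w (- x))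
   (fun x => - w' (- x)) (fun x => - H (- x)) (fun x => h (- x)) kappa theta 1).
- exact: interval_open.
- by move=> n; rewrite ltrN2 ba.
- by apply: nondecreasing_segments => m n mn; rewrite lerN2 ?a_homo ?b_homo.
- apply/seteqP; split => x /=; rewrite in_itv /=.
    rewrite -oppr_gt0 => /ab_cover[n xn]; exists n; rewrite //= in_itv /=.
    by rewrite lerNl lerNr andbC.
  move=> [n _]; rewrite /= in_itv /= => /andP[_ xb]; apply: le_lt_trans xb _.
  by rewrite oppr_lt0.
- by rewrite lebesgue_measure_itv /= ltNyr add0e ltry.
- by move=> x /io /w_gt0.
- by move=> x /io x0; apply: dN; exact: dw.
- move=> x /io x0; have := wE x0; rewrite k1 mulr1 derivX !hornerE.
  rewrite -{1}tE horner_comp !hornerE opprK => <-; ring.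
- move=> x /io x0; apply: is_derive_eq; first by apply: is_deriveN; apply: dN; exact: dH.
  by rewrite opprK.
- move=> x /io x0; apply: (@continuous_comp _ _ _ -%R h); last exact: ch.
  exact: opp_continuous.
- by move=> x /io /h_gt0 /ltW.
- by move=> x /io /H_le1; rewrite normrN.
- move=> p; have [C Ch] := w_bound (p \Po (- 'X)); exists C => x /io x0.
  by have := Ch _ x0; rewrite horner_comp !hornerE opprK.
- move=> p; have := limit_a (- (p \Po (- 'X))); apply: cvg_trans.
  apply: near_eq_cvg; apply: nearW => n.
  by rewrite k1 !hornerN horner_comp hornerN hornerX !one_at opprK; ring.
- move=> p; have := limit_b (- (p \Po (- 'X))); apply: cvg_trans.
  apply: near_eq_cvg; apply: nearW => n.
  by rewrite k1 !hornerN horner_comp hornerN hornerX !one_at opprK; ring.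
Qed.
End Weight.
End HalfLine.

Lemma powR_predr (R : realType) (s y : R) : 0 < y -> y `^ (s - 1) = y `^ s / y.
Proof. by move=> y0; rewrite powRB ?powRr1 ?(ltW y0) // (gt_eqF y0) implybT. Qed.

Lemma powR_succr (R : realType) (s y : R) : 0 < y -> y `^ (s + 1) = y `^ s * y.
Proof. by move=> y0; rewrite powRD ?powRr1 ?(ltW y0) // (gt_eqF y0) implybT. Qed.

Lemma is_derive_powR_subr (R : realType) (c s x : R) : c < x ->
  is_derive x 1 (fun y => (y - c) `^ s) (s * ((x - c) `^ s / (x - c))).
Proof.
rewrite -subr_gt0 => x0.
have -> : (fun y => (y - c) `^ s) = (fun y => y `^ s) \o (id - cst c) by [].
apply: is_derive_eq.
  by apply: is_derive1_comp; first exact: is_derive1_powR.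
by rewrite subr0 mulr1 powR_predr.
Qed.

Lemma is_derive_powR_opp (R : realType) (s x : R) : x < 0 ->
  is_derive x 1 (fun y => (- y) `^ s) (s * ((- x) `^ s / x)).
Proof.
rewrite -oppr_gt0 => x0.
have -> : (fun y => (- y) `^ s) = (fun y => y `^ s) \o -%R by [].
apply: is_derive_eq.
  by apply: is_derive1_comp; exact: is_derive1_powR.
by rewrite powR_predr // invrN; ring.
Qed.

Lemma is_derive_expR_opp (R : realType) (x : R) :
  is_derive x 1 (fun y => expR (- y)) (- expR (- x)).
Proof.
have -> : (fun y => expR (- y)) = expR \o (-%R : R -> R) by [].
by apply: is_derive_eq; rewrite mulrN1.
Qed.

Lemma is_derive_expR_opp_sqr (R : realType) (x : R) :
  is_derive x 1 (fun y => expR (- y ^+ 2)) (- (2 * x) * expR (- x ^+ 2)).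
Proof.
have -> : (fun y : R => expR (- y ^+ 2)) = expR \o (- (id * id)).
  by apply/funext => y /=; rewrite ?fctE expr2.
apply: is_derive_eq.
rewrite ?fctE /GRing.scale /= expr2; ring.
Qed.

(* [theta] is defined by [(x kappa w)' = theta w], with [kappa = x - a] for the
   Jacobi-Laguerre weight and [kappa = 1] for the Laguerre-Hermite weight. *)
Definition jacobi_laguerre_theta (R : realType) (a b g : R) : {poly R} :=
  (b + 1) *: 'X + (g + 1) *: ('X - a%:P) - 'X * ('X - a%:P).

Definition laguerre_hermite_theta (R : realType) (g : R) : {poly R} :=
  (g + 1)%:P - 2 *: 'X^2.

Lemma jacobi_laguerre_thetaE (R : realType) (a b g x : R) :
  (jacobi_laguerre_theta a b g - ('X * ('X - a%:P))^`()).[x] =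
  b * x + g * (x - a) - x * (x - a).
Proof.
rewrite /jacobi_laguerre_theta derivM derivX derivXsubC mul1r mulr1.
rewrite !(hornerD, hornerN, hornerZ, hornerM, hornerX, hornerC); ring.
Qed.

(** On this half-line [x - a] stays above [- a > 0], so the only possible singularity is that of
    [x^g] at 0, the one built into the half-line density. *)
Lemma jacobi_laguerre_pos_form (R : realType) (a b g : R) :
  a < 0 -> -1 < g ->
  exists L : {scalar {poly R}},
    [/\ forall p : {poly R},
          (\int[@lebesgue_measure R]_(x in `]0%R, +oo[)
             (p.[x] * ((x - a) `^ b * x `^ g * expR (- x)))%:E = (L p)%:E)%E,
        definite_on `]0, +oo[ L &
        pearson L ('X - a%:P) (jacobi_laguerre_theta a b g)].
Proof.
move=> a0 g1; have ax (x : R) : 0 < x -> 0 < x - a.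
  by move=> x0; rewrite subr_gt0 (lt_trans a0).
apply: (@half_line_form R g g1 _
  (fun x => ((x - a) `^ b * x `^ g * expR (- x)) * (b / (x - a) + g / x - 1))).
- by move=> x x0; rewrite !mulr_gt0 ?powR_gt0 ?expR_gt0 // ax.
- move=> x x0; have d1 : is_derive x 1 (fun y => (y - a) `^ b) (b * ((x - a) `^ b / (x - a))).
    by apply: is_derive_powR_subr; exact: lt_trans x0.
  have d2 := is_derive1_powR g x0; have d3 := is_derive_expR_opp x.
  have -> : (fun y => (y - a) `^ b * y `^ g * expR (- y)) =
    ((fun y => (y - a) `^ b) * (fun y => y `^ g)) * (fun y => expR (- y)) by [].
  apply: is_derive_eq; rewrite ?fctE /GRing.scale /= powR_predr //; ring.
- move=> x x0; rewrite jacobi_laguerre_thetaE hornerXsubC; field.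
  by rewrite !gt_eqF // ax.
- move=> p; have [|C Ch] := half_line_density_bound g1 b p (c := - a).
    by rewrite oppr_gt0.
  by exists C.
Qed.

Lemma laguerre_hermite_forms (R : realType) (g : R) : -1 < g ->
  (exists L : {scalar {poly R}},
    [/\ forall p : {poly R},
          (\int[@lebesgue_measure R]_(x in `]0%R, +oo[)
             (p.[x] * (x `^ g * expR (- x ^+ 2)))%:E = (L p)%:E)%E,
        definite_on `]0, +oo[ L & pearson L 1 (laguerre_hermite_theta g)]) /\
  (exists L : {scalar {poly R}},
    [/\ forall p : {poly R},
          (\int[@lebesgue_measure R]_(x in `]-oo, 0%R[)
             (p.[x] * ((- x) `^ g * expR (- (- x) ^+ 2)))%:E = (L p)%:E)%E,
        definite_on `]-oo, 0[ L & pearson L 1 (laguerre_hermite_theta g)]).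
Proof.
move=> g1.
pose w (x : R) := x `^ g * expR (- x ^+ 2); pose w' (x : R) := w x * (g / x - 2 * x).
have w0 (x : R) : 0 < x -> 0 < w x by move=> x0; rewrite mulr_gt0 ?powR_gt0 ?expR_gt0.
have dw (x : R) : 0 < x -> is_derive x 1 w (w' x).
  move=> x0; have d2 := is_derive1_powR g x0; have d3 := is_derive_expR_opp_sqr x.
  have -> : w = (fun y => y `^ g) * (fun y => expR (- y ^+ 2)) by [].
  apply: is_derive_eq; rewrite ?fctE /GRing.scale /= powR_predr // /w' /w; ring.
have wE (x : R) : 0 < x ->
    x * (1 : {poly R}).[x] * w' x = (laguerre_hermite_theta g - ('X * 1)^`()).[x] * w x.
  move=> x0; rewrite /laguerre_hermite_theta mulr1 derivX /w'.
  rewrite !(hornerD, hornerN, hornerZ, hornerXn, hornerC); field.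
  by rewrite gt_eqF.
have bd (p : {poly R}) : exists C, forall x : R, 0 < x ->
    `|p.[x]| * w x <= C * half_line_density g x.
  have [C Ch] := half_line_density_bound g1 0 p (@ltr01 R).
  (* The inequality [- x^2 <= 1 - x] bounds the Gaussian factor by [e * e^(-x)]. *)
  exists (C * expR 1) => x x0; apply: (@le_trans _ _ (`|p.[x]| * (x `^ g * expR (- x)) * expR 1)).
    rewrite -!mulrA -expRD; apply: ler_wpM2l => //; apply: ler_wpM2l; first exact: powR_ge0.
    by rewrite ler_expR; nra.
  have := Ch x x0; rewrite powRr0 mul1r => le.
  by rewrite [leRHS]mulrAC; apply: ler_wpM2r le; exact: expR_ge0.
split; first exact: half_line_form w0 dw wE bd.
apply: (half_line_form_neg g1 w0 dw wE bd) => //.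
rewrite /laguerre_hermite_theta comp_polyB comp_polyC comp_polyZ.
by rewrite comp_Xn_poly sqrrN.
Qed.

(** * The Jacobi-Laguerre weight on the bounded interval *)

Section BoundedInterval.
Variables (R : realType) (a b g : R).
Hypotheses (a0 : a < 0) (b1 : -1 < b) (g1 : -1 < g).
Let b1p : 0 < b + 1. Proof. by rewrite -ltrBlDr sub0r. Qed.
Let g1p : 0 < g + 1. Proof. by rewrite -ltrBlDr sub0r. Qed.
Let w (x : R) := (x - a) `^ b * (- x) `^ g * expR (- x).
(** The majorant on [(a, 0)]: one power for the singularity at each endpoint. It is the derivative
    of [H], where the minus sign compensates that of [- x]. *)
Let h (x : R) := (b + 1) * (x - a) `^ b + (g + 1) * (- x) `^ g.
Let H (x : R) := (x - a) `^ (b + 1) - (- x) `^ (g + 1).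
Let A_gt0 : 0 < - a. Proof. by rewrite oppr_gt0. Qed.

Let inI (x : R) : x \in `]a, 0[ -> [/\ a < x, x < 0, 0 < x - a & 0 < - x].
Proof. by rewrite in_itv /= => /andP[ax x0]; split; rewrite ?subr_gt0 ?oppr_gt0. Qed.

Let dw (x : R) : x \in `]a, 0[ -> is_derive x 1 w (w x * (b / (x - a) + g / x - 1)).
Proof.
move=> /inI[ax x0 ax0 x00]; have d1 := is_derive_powR_subr b ax.
have d2 := is_derive_powR_opp g x0; have d3 := is_derive_expR_opp x.
have -> : w = ((fun y => (y - a) `^ b) * (fun y => (- y) `^ g)) * (fun y => expR (- y)) by [].
by apply: is_derive_eq; rewrite ?fctE /GRing.scale /=; ring.
Qed.

Let dH (x : R) : x \in `]a, 0[ -> is_derive x 1 H (h x).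
Proof.
move=> /inI[ax x0 ax0 x00]; have d1 := is_derive_powR_subr (b + 1) ax.
have d2 := is_derive_powR_opp (g + 1) x0.
have -> : H = (fun y => (y - a) `^ (b + 1)) - (fun y => (- y) `^ (g + 1)) by [].
apply: is_derive_eq; rewrite !powR_succr // /h; field.
by rewrite (gt_eqF ax0) (lt_eqF x0).
Qed.

Let ch (x : R) : x \in `]a, 0[ -> {for x, continuous h}.
Proof.
move=> /inI[ax x0 ax0 x00]; have d1 := is_derive_powR_subr b ax.
have d2 := is_derive_powR_opp g x0.
apply: differentiable_continuous; rewrite -derivable1_diffP.
have -> : h = cst (b + 1) * (fun y => (y - a) `^ b) + cst (g + 1) * (fun y => (- y) `^ g) by [].
by apply: derivableD; apply: derivableM.
Qed.

Let h_ge0 (x : R) : 0 <= h x.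
Proof. by rewrite addr_ge0 ?mulr_ge0 ?powR_ge0 // ltW. Qed.

Let H_le (x : R) : x \in `]a, 0[ -> `|H x| <= (- a) `^ (b + 1) + (- a) `^ (g + 1).
Proof.
move=> /inI[ax x0 ax0 x00]; apply: le_trans (ler_normB _ _) _.
rewrite !ger0_norm ?powR_ge0 //.
by apply: lerD; apply: ge0_ler_powR; rewrite ?nnegrE ?(ltW b1p) ?(ltW g1p) //; lra.
Qed.

(** To the left of the midpoint [- x] lies between [- a / 2] and [- a], and to the right [x - a]
    does; so one of the two powers is always bounded by [K], and the other one is a term of [h] up
    to the coefficients [b + 1] and [g + 1]. *)
Let w_le : exists C, 0 <= C /\ {in `]a, 0[, forall x, w x <= C * h x}.
Proof.
pose l := - a / 2; have l0 : 0 < l by rewrite divr_gt0.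
pose K := (l `^ b + (- a) `^ b) + (l `^ g + (- a) `^ g).
have K0 : 0 <= K by rewrite !addr_ge0 ?powR_ge0.
exists (K * expR (- a) * ((b + 1)^-1 + (g + 1)^-1)); split.
  by rewrite !mulr_ge0 ?expR_ge0 // addr_ge0 // invr_ge0 ltW.
move=> x /inI[ax x0 ax0 x00].
have wK : (x - a) `^ b * (- x) `^ g <= K * ((x - a) `^ b + (- x) `^ g).
  have pb := powR_ge0 (x - a) b; have pg := powR_ge0 (- x) g.
  have qb : 0 <= l `^ b + (- a) `^ b by rewrite addr_ge0 ?powR_ge0.
  have qg : 0 <= l `^ g + (- a) `^ g by rewrite addr_ge0 ?powR_ge0.
  have [xl|xl] := leP (x - a) l.
    have := @powR_le_ends R g l (- a) (- x) l0.
    rewrite /K => /(_ ltac:(rewrite /l; rewrite /l in xl; lra) ltac:(lra)); nra.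
  have := @powR_le_ends R b l (- a) (x - a) l0 (ltW xl).
  rewrite /K => /(_ ltac:(lra)); nra.
have hK : (x - a) `^ b + (- x) `^ g <= ((b + 1)^-1 + (g + 1)^-1) * h x.
  rewrite /h mulrDl !mulrDr !mulKf ?gt_eqF //.
  have pb := powR_ge0 (x - a) b; have pg := powR_ge0 (- x) g.
  have ib : 0 <= (b + 1)^-1 * ((g + 1) * (- x) `^ g) by rewrite !mulr_ge0 ?invr_ge0 // ltW.
  have ig : 0 <= (g + 1)^-1 * ((b + 1) * (x - a) `^ b) by rewrite !mulr_ge0 ?invr_ge0 // ltW.
  lra.
have -> : K * expR (- a) * ((b + 1)^-1 + (g + 1)^-1) * h x =
  K * (((b + 1)^-1 + (g + 1)^-1) * h x) * expR (- a) by ring.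
apply: ler_pM; rewrite ?mulr_ge0 ?powR_ge0 ?expR_ge0 //.
  by apply: le_trans wK _; exact: ler_wpM2l.
by rewrite ler_expR lerN2 ltW.
Qed.

Let pw_le (p : {poly R}) : exists C, {in `]a, 0[, forall x, `|p.[x]| * w x <= C * h x}.
Proof.
have [C1 [k [C10 b_]]] := horner_growth p; have [C2 [C20 wb]] := w_le.
exists (C1 * (1 - a) ^+ k * C2) => x xI; have [ax x0 ax0 x00] := inI xI.
rewrite -[leRHS]mulrA; apply: ler_pM => //; [|  |exact: wb].
  by rewrite /w !mulr_ge0 ?powR_ge0 ?expR_ge0.
apply: le_trans (b_ x) _; apply: ler_wpM2l => //.
by apply: lerXn2r; rewrite ?nnegrE ?(ltr0_norm x0); lra.
Qed.

(** The offset 3 makes [2 * e_ n < - a] strict from [n = 0] on, so that [a + e_ n] lies to the left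
    of [- e_ n]. *)
Let e_ (n : nat) : R := - a / n.+3%:R.
Let e_gt0 n : 0 < e_ n. Proof. by rewrite divr_gt0 ?ltr0n. Qed.
Let e_homo : {homo e_ : m n / (m <= n)%N >-> n <= m}.
Proof.
move=> m n mn; rewrite /e_ ler_pM2l // lef_pV2 ?posrE ?ltr0n //.
by rewrite ler_nat.
Qed.
Let e_lt n : 2 * e_ n < - a.
Proof.
rewrite /e_ mulrA ltr_pdivrMr ?ltr0n // mulrC ltr_pM2l //.
by rewrite ltr_nat.
Qed.
Let e_small (y : R) : 0 < y -> exists N, forall n, (N <= n)%N -> e_ n <= y.
Proof.
move=> y0; exists (Num.truncn (- a / y)) => n Nn.
rewrite /e_ ler_pdivrMr ?ltr0n // mulrC -ler_pdivrMr //.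
apply: le_trans (ltW (truncnS_gt _)) _.
by rewrite ler_nat ltnS; do 2 apply: leqW.
Qed.
Let e_cvg0 : e_ n @[n --> \oo] --> 0.
Proof.
apply: (@cvg0_le _ _ (@harmonic R) (- a)); last exact: cvg_harmonic.
move=> n; rewrite gtr0_norm // ler_pM2l // lef_pV2 ?posrE ?ltr0n //.
by rewrite ler_nat ltnS leqW.
Qed.
Let e_powR_cvg0 s : 0 < s -> e_ n `^ s @[n --> \oo] --> 0.
Proof. by move=> s0; have /cvg_at_rightP := powR_cvg0 s0; apply; split. Qed.

(** The factor [x (x - a)] raises the exponents of [h] to [b + 1] and [g + 1], both positive. At
    either endpoint one term then tends to 0 through its power and the other through its linear
    factor. *)
Let limit_bound (p : {poly R}) : exists C, {in `]a, 0[, forall x,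
  `|p.[x] * (x * ('X - a%:P).[x] * w x)| <=
  C * ((b + 1) * (- x) * (x - a) `^ (b + 1) + (g + 1) * (x - a) * (- x) `^ (g + 1))}.
Proof.
have [C Ch] := pw_le p; exists C => x xI; have [ax x0 ax0 x00] := inI xI.
have w0 : 0 <= w x by rewrite /w !mulr_ge0 ?powR_ge0 ?expR_ge0.
move: (w x) w0 (Ch x xI) => W W0 ChW.
rewrite hornerXsubC !normrM (ltr0_norm x0) (gtr0_norm ax0) (ger0_norm W0) !powR_succr //.
have -> : `|p.[x]| * (- x * (x - a) * W) = `|p.[x]| * W * (- x * (x - a)) by ring.
have -> : C * ((b + 1) * - x * ((x - a) `^ b * (x - a)) + (g + 1) * (x - a) * ((- x) `^ g * - x)) =
  C * h x * (- x * (x - a)) by rewrite /h; ring.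
by apply: ler_wpM2r; [rewrite mulr_ge0 // ltW|exact: ChW].
Qed.

Let u_ n := a + e_ n.
Let v_ n := - e_ n.
Let u_in n : u_ n \in `]a, 0[.
Proof. by rewrite in_itv /= /u_; have := e_gt0 n; have := e_lt n; lra. Qed.
Let v_in n : v_ n \in `]a, 0[.
Proof. by rewrite in_itv /= /v_; have := e_gt0 n; have := e_lt n; lra. Qed.

Let sum_cvg0 (k1 k2 s : R) : 0 < s -> k1 * e_ n `^ s + k2 * e_ n @[n --> \oo] --> 0.
Proof.
move=> s0; rewrite -[X in _ --> X]addr0; apply: cvgD.
  by rewrite -[X in _ --> X](mulr0 k1); apply: cvgM; [exact: cvg_cst|exact: e_powR_cvg0].
by rewrite -[X in _ --> X](mulr0 k2); apply: cvgM; [exact: cvg_cst|exact: e_cvg0].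
Qed.

Let limit_u (p : {poly R}) :
  p.[u_ n] * (u_ n * ('X - a%:P).[u_ n] * w (u_ n)) @[n --> \oo] --> 0.
Proof.
have [C Ch] := limit_bound p; apply: cvg0_le (fun n => Ch _ (u_in n)) _.
apply: (@cvg0_le _ _ (fun n => ((b + 1) * - a) * e_ n `^ (b + 1) +
  ((g + 1) * (- a) `^ (g + 1)) * e_ n) 1); last exact: sum_cvg0.
move=> n; have [ax x0 ax0 x00] := inI (u_in n); rewrite mul1r ger0_norm; last first.
  by rewrite addr_ge0 // !mulr_ge0 ?powR_ge0 // ltW.
have -> : u_ n - a = e_ n by rewrite /u_; ring.
have en := e_gt0 n; have ua : - u_ n <= - a by rewrite /u_; lra.
apply: lerD; first by rewrite ler_wpM2r ?powR_ge0 // ler_wpM2l // ltW.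
rewrite mulrAC ler_wpM2r ?(ltW en) // ler_wpM2l ?(ltW g1p) //.
by apply: ge0_ler_powR; rewrite ?nnegrE ?(ltW g1p) ?(ltW x00) ?(ltW A_gt0).
Qed.

Let limit_v (p : {poly R}) :
  p.[v_ n] * (v_ n * ('X - a%:P).[v_ n] * w (v_ n)) @[n --> \oo] --> 0.
Proof.
have [C Ch] := limit_bound p; apply: cvg0_le (fun n => Ch _ (v_in n)) _.
apply: (@cvg0_le _ _ (fun n => ((g + 1) * - a) * e_ n `^ (g + 1) +
  ((b + 1) * (- a) `^ (b + 1)) * e_ n) 1); last exact: sum_cvg0.
move=> n; have [ax x0 ax0 x00] := inI (v_in n); rewrite mul1r ger0_norm; last first.
  by rewrite addr_ge0 // !mulr_ge0 ?powR_ge0 // ltW.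
have -> : - v_ n = e_ n by rewrite /v_ opprK.
have en := e_gt0 n; have va : v_ n - a <= - a by rewrite /v_; lra.
rewrite addrC; apply: lerD; first by rewrite ler_wpM2r ?powR_ge0 // ler_wpM2l // ltW.
rewrite mulrAC ler_wpM2r ?(ltW en) // ler_wpM2l ?(ltW b1p) //.
by apply: ge0_ler_powR; rewrite ?nnegrE ?(ltW b1p) ?(ltW ax0) ?(ltW A_gt0).
Qed.

Lemma jacobi_laguerre_neg_form :
  exists L : {scalar {poly R}},
    [/\ forall p : {poly R},
          (\int[@lebesgue_measure R]_(x in `]a, 0%R[)
             (p.[x] * ((x - a) `^ b * (- x) `^ g * expR (- x)))%:E = (L p)%:E)%E,
        definite_on `]a, 0[ L &
        pearson L ('X - a%:P) (jacobi_laguerre_theta a b g)].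
Proof.
apply: (@weighted_form R `]a, 0[ u_ v_ w (fun x => w x * (b / (x - a) + g / x - 1)) H h
  _ _ ((- a) `^ (b + 1) + (- a) `^ (g + 1))).
- exact: interval_open.
- by move=> n; rewrite /u_ /v_; have := e_lt n; lra.
- apply: nondecreasing_segments => m n mn; rewrite /u_ /v_; have := e_homo mn; lra.
- apply/seteqP; split => x /=; last first.
    move=> [n _] /=; have := u_in n; have := v_in n; rewrite !in_itv /=.
    by move=> /andP[_ ?] /andP[? _] /andP[? ?]; apply/andP; split; lra.
  move=> /inI[ax x0 ax0 x00]; have [N1 e1] := e_small ax0; have [N2 e2] := e_small x00.
  exists (N1 + N2)%N => //=; rewrite in_itv /= /u_ /v_.
  have := e1 _ (leq_addr N2 N1); have := e2 _ (leq_addl N1 N2); lra.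
- by rewrite lebesgue_measure_itv /= lte_fin a0 add0e lte_fin oppr_gt0.
- by move=> x /inI[ax x0 ax0 x00]; rewrite /w !mulr_gt0 ?powR_gt0 ?expR_gt0.
- exact: dw.
- move=> x /inI[ax x0 ax0 x00]; rewrite jacobi_laguerre_thetaE hornerXsubC; field.
  by rewrite (gt_eqF ax0) (lt_eqF x0).
- exact: dH.
- exact: ch.
- by move=> x _; exact: h_ge0.
- exact: H_le.
- exact: pw_le.
- exact: limit_u.
- exact: limit_v.
Qed.
End BoundedInterval.

End Integrals.

(** * Interlacing of the zeros *)

Lemma simple_zeros_root_poly (R : realType) (I : interval R) (s s' : seq R) :
  uniq s -> sorted <%R s' -> (forall x, x \in s' <-> x \in I /\ x \in s) ->
  simple_zeros_in I (root_poly s) s'.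
Proof.
move=> us ss' mem; split=> // [x|x /mem[_ xs]]; first by rewrite /root_poly root_prod_XsubC.
rewrite /root_poly (big_rem x) //= mupMl; last by rewrite root_prod_XsubC mem_rem_uniqF.
by rewrite -['X - _]expr1 mup_XsubCX eqxx.
Qed.

Lemma interlace_on_root_poly (R : realType) (I : interval R) (s t s' t' : seq R) :
  sorted <%R s -> sorted <%R t -> sorted <%R s' -> sorted <%R t' ->
  (forall x, x \in s' <-> x \in I /\ x \in s) ->
  (forall x, x \in t' <-> x \in I /\ x \in t) ->
  size t' = size s' \/ (size t').+1 = size s' -> interleaved s' t' ->
  interlace_on I (root_poly s) (root_poly t).
Proof.
move=> ss st ss' st' ms mt sz [alt1 alt2]; exists s', t'; split=> //.
  by apply: simple_zeros_root_poly => //; move: ss; rewrite lt_sorted_uniq_le => /andP[].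
by apply: simple_zeros_root_poly => //; move: st; rewrite lt_sorted_uniq_le => /andP[].
Qed.

Lemma interlace_root_poly (R : realType) (s t : seq R) :
  sorted <%R s -> sorted <%R t ->
  size t = size s \/ (size t).+1 = size s -> interleaved s t ->
  interlace (root_poly s) (root_poly t).
Proof.
move=> ss st sz alt; apply: interlace_on_root_poly sz alt => // x;
by split=> [|[]].
Qed.

Section Localization.
Variable R : realType.
Implicit Types s t : seq R.

Let nth_cat_addn s1 s2 i : (s1 ++ s2)`_(size s1 + i) = s2`_i.
Proof. by rewrite nth_cat ltnNge leq_addr addKn. Qed.

(** Each block of [s] has one element more than the matching block of [t], so the inserted 0
    separates [s1] from [s2] and the chain splits there without a change of orientation. *)
Lemma interleaved_cat0 s1 s2 t1 t2 : size s1 = (size t1).+1 -> size s2 = (size t2).+1 ->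
  interleaved (s1 ++ s2) (t1 ++ 0 :: t2) -> interleaved s1 t1 /\ interleaved s2 t2.
Proof.
move=> z1 z2 [alt1 alt2]; split; split=> i hi.
- have := alt1 i; rewrite !nth_cat hi (_ : (i < size s1)%N); last by rewrite z1 ltnW.
  by apply; rewrite size_cat (leq_trans hi) // leq_addr.
- have := alt2 i; rewrite !nth_cat hi; move: (hi); rewrite z1 ltnS => ->.
  by apply; rewrite size_cat (leq_trans hi) // leq_addr.
- have := alt1 (size s1 + i)%N; rewrite nth_cat_addn z1 (addSnnS (size t1) i).
  rewrite nth_cat_addn /=; apply.
  by rewrite size_cat /= ltn_add2l ltnS.
- have := alt2 (size s1 + i)%N; rewrite -addnS nth_cat_addn z1 (addSnnS (size t1) i).
  rewrite nth_cat_addn /=; apply.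
  by rewrite size_cat z1 ltn_add2l.
Qed.

(** Here 0 belongs to the list that starts the chain. To its right the next element comes from [t2],
    so the orientation is reversed on that side. *)
Lemma interleaved_0cat s1 s2 t1 t2 : size s1 = size t1 -> size s2 = size t2 ->
  interleaved (s1 ++ 0 :: s2) (t1 ++ t2) -> interleaved s1 t1 /\ interleaved t2 s2.
Proof.
move=> z1 z2 [alt1 alt2]; split; split=> i hi.
- have := alt1 i; rewrite !nth_cat hi (_ : (i < size s1)%N) ?z1 //.
  by apply; rewrite size_cat (leq_trans hi) // leq_addr.
- have := alt2 i; rewrite !nth_cat hi -z1 (ltnW hi).
  by apply; rewrite size_cat (leq_trans hi) // leq_addr.
- have := alt2 (size s1 + i)%N; rewrite -addnS nth_cat_addn z1 nth_cat_addn /=; apply.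
  by rewrite size_cat /= z1 ltn_add2l ltnS.
- have := alt1 (size s1 + i.+1)%N; rewrite nth_cat_addn z1 nth_cat_addn /=; apply.
  by rewrite size_cat ltn_add2l.
Qed.

End Localization.

Section PearsonInterlace.
Variables (R : realType) (I1 I2 : interval R) (L1 L2 : {scalar {poly R}}).
Variables (kappa theta P S q : {poly R}) (m : nat).
Hypothesis sys : pearson_system I1 I2 L1 L2 kappa theta.
Hypothesis orthq : multiple_orthogonal L1 L2 ('X * kappa) m q.
Hypothesis orthP : multiple_orthogonal L1 L2 1 m.+1 P.
Hypothesis orthS : multiple_orthogonal L1 L2 'X m.+1 S.

Let mem_split n f s1 s2 : zeros_split I1 I2 n f s1 s2 ->
  (forall x, x \in s1 <-> x \in I1 /\ x \in s1 ++ s2) /\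
  (forall x, x \in s2 <-> x \in I2 /\ x \in s1 ++ s2).
Proof.
case=> _ [sI1 sI2] _ _ _; have ng := pearson_neg sys; have ps := pearson_pos sys.
have abs x : x \in I1 -> x \in I2 -> False by move=> /ng xn /ps; rewrite ltNge ltW.
split=> x; split.
- by move=> x1; rewrite mem_cat x1; split=> //; exact: sI1.
- by move=> [xI]; rewrite mem_cat => /orP[//|/sI2 /(abs _ xI)].
- by move=> x2; rewrite mem_cat x2 orbT; split=> //; exact: sI2.
- by move=> [xI]; rewrite mem_cat => /orP[/sI1 /abs|//]; case.
Qed.

Let sorted_split n f s1 s2 : zeros_split I1 I2 n f s1 s2 ->
  sorted <%R s1 /\ sorted <%R s2.
Proof.
by case=> ss _ _ _ _; split; apply: subseq_sorted ss; try exact: lt_trans;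
  [exact: prefix_subseq|exact: suffix_subseq].
Qed.

Let interlace_split n n' f f' s1 s2 t1 t2 :
  zeros_split I1 I2 n f s1 s2 -> zeros_split I1 I2 n' f' t1 t2 ->
  n' = n \/ n'.+1 = n ->
  (interleaved s1 t1 -> interlace_on I1 f f') /\
  (interleaved s2 t2 -> interlace_on I2 f f').
Proof.
move=> zs zt nn; have [ms1 ms2] := mem_split zs; have [mt1 mt2] := mem_split zt.
have [ss1 ss2] := sorted_split zs; have [st1 st2] := sorted_split zt.
case: zs zt => ss _ -> z1 z2 [st _ -> w1 w2].
by split; apply: interlace_on_root_poly; rewrite ?z1 ?z2 ?w1 ?w2.
Qed.

Let PE : P = raised kappa theta 0 q 0.
Proof.
exact: multiple_orthogonal_unique (angelesco_system1 sys) orthP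
  (raised_multiple_orthogonal1 sys orthq).
Qed.

Let SE : S = raised kappa theta kappa q m.+1.
Proof.
exact: multiple_orthogonal_unique (angelesco_systemX sys) orthS
  (raised_multiple_orthogonalX sys orthq).
Qed.

Lemma pearson_interlace :
  (interlace_on I1 S P /\ interlace_on I1 P q) /\
  (interlace_on I2 P S /\ interlace_on I2 S q).
Proof.
have [q1 [q2 zq]] := multiple_orthogonal_factor (angelesco_systemX_kappa sys) orthq.
have [p1 [p2 zp]] := multiple_orthogonal_factor (angelesco_system1 sys) orthP.
have [s1 [s2 zs]] := multiple_orthogonal_factor (angelesco_systemX sys) orthS.
have [sp1 sp2] := interlace_split zs zp (or_introl erefl).
have [ps1 ps2] := interlace_split zp zs (or_introl erefl).
have [pq1 pq2] := interlace_split zp zq (or_intror erefl).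
have [sq1 sq2] := interlace_split zs zq (or_intror erefl).
case: (zq) (zp) (zs) => _ _ _ u1 u2 [_ _ _ v1 v2] [_ _ _ w1 w2].
rewrite PE in zp; rewrite SE in zs.
have [|||P1 P2] := interleaved_cat0 (s1 := p1) (s2 := p2) (t1 := q1) (t2 := q2).
- by rewrite u1 v1.
- by rewrite u2 v2.
- by apply: (interleaved_raised sys zq _ zp); rewrite horner0.
have [|||S1 S2] := interleaved_cat0 (s1 := s1) (s2 := s2) (t1 := q1) (t2 := q2).
- by rewrite u1 w1.
- by rewrite u2 w2.
- by apply: (interleaved_raised sys zq _ zs); exact/ltW/(pearson_kappa0 sys).
have [|||SP1 PS2] := interleaved_0cat (s1 := s1) (s2 := s2) (t1 := p1) (t2 := p2).
- by rewrite v1 w1.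
- by rewrite v2 w2.
- exact: (interleaved_raised_kappa sys zq zp zs).
exact: (conj (conj (sp1 SP1) (pq1 P1)) (conj (ps2 PS2) (sq2 S2))).
Qed.

Lemma pearson_interlace_kappa a T : kappa = 'X - a%:P ->
  multiple_orthogonal L1 L2 kappa m.+1 T ->
  interlace P T /\ interlace T ('X * q).
Proof.
move=> kE orthT.
have TE : T = raised kappa theta 'X q m.+1.
  exact: multiple_orthogonal_unique (angelesco_system_kappa sys) orthT
    (raised_multiple_orthogonal_kappa sys orthq kE).
have [q1 [q2 zq]] := multiple_orthogonal_factor (angelesco_systemX_kappa sys) orthq.
have [p1 [p2 zp]] := multiple_orthogonal_factor (angelesco_system1 sys) orthP.
have [t1 [t2 zt]] := multiple_orthogonal_factor (angelesco_system_kappa sys) orthT.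
have sq0 := sorted_insert0 sys zq.
case: (zq) (zp) (zt) => _ _ qE u1 u2 [sp _ pE v1 v2] [st _ tE w1 w2].
rewrite PE in zp; rewrite TE in zt.
rewrite {1}qE -root_poly_insert0 pE tE; split; apply: interlace_root_poly => //.
- by left; rewrite !size_cat v1 v2 w1 w2.
- exact: (interleaved_raisedX sys zq zp zt).
- by right; rewrite !size_cat /= u1 u2 w1 w2 addSn.
- by apply: (interleaved_raised sys zq _ zt); rewrite hornerX.
Qed.
End PearsonInterlace.

(** * The classical polynomials as instances *)

Lemma integral_form_eq0 (R : realType) (D : set R) (w w' : R -> R) (u : {poly R}) (c : R)
    (L : {scalar {poly R}}) (f : R -> R) (p : {poly R}) :
  (forall p : {poly R},
    (\int[@lebesgue_measure R]_(x in D) (p.[x] * w x)%:E = (L p)%:E)%E) ->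
  c != 0 -> (forall x, D x -> w' x = c * (u.[x] * w x)) ->
  (forall x, D x -> f x = p.[x] * w' x) ->
  (\int[@lebesgue_measure R]_(x in D) (f x)%:E = 0)%E <-> L (u * p) = 0.
Proof.
move=> LE c0 w'E fE.
have -> : (\int[@lebesgue_measure R]_(x in D) (f x)%:E = (c * L (u * p))%:E)%E.
  have -> : c * L (u * p) = L (c *: (u * p)) by rewrite linearZ.
  rewrite -LE; apply: eq_integral => x /set_mem xD.
  by rewrite fE // w'E // hornerZ hornerM; congr (_%:E); ring.
split=> [[] /eqP|->]; last by rewrite mulr0.
by rewrite mulf_eq0 (negbTE c0) => /eqP.
Qed.

(** The constant [c] accounts for [|x| = - x] on the left: it is [-1] when [u] contains the factor
    [x], and 1 otherwise. Existence for the weight multiplied by [u] is what makes [xget] return a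
    polynomial with the defining property. *)
Lemma jacobi_laguerre_orthogonal (R : realType) (a b g b' g' c : R) (L1 L2 : {scalar {poly R}})
    (u : {poly R}) n :
  (forall p : {poly R}, (\int[@lebesgue_measure R]_(x in `]a, 0%R[)
     (p.[x] * ((x - a) `^ b * (- x) `^ g * expR (- x)))%:E = (L1 p)%:E)%E) ->
  (forall p : {poly R}, (\int[@lebesgue_measure R]_(x in `]0%R, +oo[)
     (p.[x] * ((x - a) `^ b * x `^ g * expR (- x)))%:E = (L2 p)%:E)%E) ->
  angelesco_system `]a, 0[ `]0, +oo[ L1 L2 u ->
  c != 0 ->
  (forall x, a < x -> x < 0 ->
     (x - a) `^ b' * (- x) `^ g' = c * (u.[x] * ((x - a) `^ b * (- x) `^ g))) ->
  (forall x, 0 < x -> (x - a) `^ b' * x `^ g' = u.[x] * ((x - a) `^ b * x `^ g)) ->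
  multiple_orthogonal L1 L2 u n (jacobi_laguerre a b' g' n).
Proof.
move=> LE1 LE2 sys c0 w1 w2.
have eq1 k p : (\int[@lebesgue_measure R]_(x in `]a, 0%R[)
    (x ^+ k * p.[x] * (x - a) `^ b' * `|x| `^ g' * expR (- x))%:E = 0)%E <->
    L1 ('X^k * (u * p)) = 0.
  rewrite mulrCA; apply: (integral_form_eq0
    (w' := fun x => (x - a) `^ b' * (- x) `^ g' * expR (- x)) LE1 c0).
    by move=> x /=; rewrite in_itv /= => /andP[ax x0]; rewrite w1 //; ring.
  move=> x /=; rewrite in_itv /= => /andP[ax x0].
  by rewrite hornerM hornerXn ltr0_norm //; ring.
have eq2 k p : (\int[@lebesgue_measure R]_(x in `]0%R, +oo[)
    (x ^+ k * p.[x] * (x - a) `^ b' * x `^ g' * expR (- x))%:E = 0)%E <->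
    L2 ('X^k * (u * p)) = 0.
  rewrite mulrCA; apply: (integral_form_eq0
    (w' := fun x => (x - a) `^ b' * x `^ g' * expR (- x)) LE2 (oner_neq0 R)).
    by move=> x /=; rewrite in_itv /= andbT => x0; rewrite w2 //; ring.
  by move=> x _; rewrite hornerM hornerXn; ring.
have [] : is_jacobi_laguerre a b' g' n (jacobi_laguerre a b' g' n); last first.
  by move=> mp sp o; split=> // k kn; have [/eq1 o1 /eq2 o2] := o k kn.
apply: xgetPex; have [p [mp sp o1 o2]] := multiple_orthogonal_exists n sys.
by exists p; split=> // k kn; split; [apply/eq1/o1|apply/eq2/o2].
Qed.

Lemma laguerre_hermite_orthogonal (R : realType) (g g' c : R) (L1 L2 : {scalar {poly R}})
    (u : {poly R}) n :
  (forall p : {poly R}, (\int[@lebesgue_measure R]_(x in `]-oo, 0%R[)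
     (p.[x] * ((- x) `^ g * expR (- (- x) ^+ 2)))%:E = (L1 p)%:E)%E) ->
  (forall p : {poly R}, (\int[@lebesgue_measure R]_(x in `]0%R, +oo[)
     (p.[x] * (x `^ g * expR (- x ^+ 2)))%:E = (L2 p)%:E)%E) ->
  angelesco_system `]-oo, 0[ `]0, +oo[ L1 L2 u ->
  c != 0 ->
  (forall x, x < 0 -> (- x) `^ g' = c * (u.[x] * (- x) `^ g)) ->
  (forall x, 0 < x -> x `^ g' = u.[x] * x `^ g) ->
  multiple_orthogonal L1 L2 u n (laguerre_hermite g' n).
Proof.
move=> LE1 LE2 sys c0 w1 w2.
have eq1 k p : (\int[@lebesgue_measure R]_(x in `]-oo, 0%R[)
    (x ^+ k * p.[x] * `|x| `^ g' * expR (- x ^+ 2))%:E = 0)%E <->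
    L1 ('X^k * (u * p)) = 0.
  rewrite mulrCA; apply: (integral_form_eq0
    (w' := fun x => (- x) `^ g' * expR (- (- x) ^+ 2)) LE1 c0).
    by move=> x /=; rewrite in_itv /= => x0; rewrite w1 //; ring.
  move=> x /=; rewrite in_itv /= => x0.
  by rewrite hornerM hornerXn ltr0_norm // sqrrN; ring.
have eq2 k p : (\int[@lebesgue_measure R]_(x in `]0%R, +oo[)
    (x ^+ k * p.[x] * x `^ g' * expR (- x ^+ 2))%:E = 0)%E <->
    L2 ('X^k * (u * p)) = 0.
  rewrite mulrCA; apply: (integral_form_eq0
    (w' := fun x => x `^ g' * expR (- x ^+ 2)) LE2 (oner_neq0 R)).
    by move=> x /=; rewrite in_itv /= andbT => x0; rewrite w2 //; ring.
  by move=> x _; rewrite hornerM hornerXn; ring.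
have [] : is_laguerre_hermite g' n (laguerre_hermite g' n); last first.
  by move=> mp sp o; split=> // k kn; have [/eq1 o1 /eq2 o2] := o k kn.
apply: xgetPex; have [p [mp sp o1 o2]] := multiple_orthogonal_exists n sys.
by exists p; split=> // k kn; split; [apply/eq1/o1|apply/eq2/o2].
Qed.

Lemma size_quadratic (R : realType) (c : R) (p : {poly R}) : c != 0 -> (size p <= 2)%N ->
  size (c *: 'X^2 + p) = 3%N /\ lead_coef (c *: 'X^2 + p) = c.
Proof.
move=> c0 sp; have s2 : size (c *: 'X^2) = 3%N by rewrite size_scale // size_polyXn.
by rewrite size_polyDl ?lead_coefDl ?s2 ?ltnS // lead_coefZ lead_coefXn mulr1.
Qed.

Lemma jacobi_laguerre_system (R : realType) (a b g : R) (L1 L2 : {scalar {poly R}}) :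
  a < 0 -> -1 < g ->
  definite_on `]a, 0[ L1 -> definite_on `]0, +oo[ L2 ->
  pearson L1 ('X - a%:P) (jacobi_laguerre_theta a b g) ->
  pearson L2 ('X - a%:P) (jacobi_laguerre_theta a b g) ->
  pearson_system `]a, 0[ `]0, +oo[ L1 L2 ('X - a%:P) (jacobi_laguerre_theta a b g).
Proof.
move=> a0 g1 d1 d2 e1 e2; have g10 : 0 < g + 1 by rewrite -ltrBlDr sub0r.
(* The expanded form displays the two signs required: leading coefficient [-1], and value
   [- (g + 1) a > 0] at 0. *)
have tE : jacobi_laguerre_theta a b g = (-1) *: 'X^2 + (b + g + 2 + a) *: 'X - ((g + 1) * a)%:P.
  by rewrite /jacobi_laguerre_theta -!mul_polyC; ring.
have [st lt] : size (jacobi_laguerre_theta a b g) = 3%N /\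
    lead_coef (jacobi_laguerre_theta a b g) = -1.
  rewrite tE -addrA; apply: size_quadratic; first by rewrite oppr_eq0 oner_eq0.
  apply: leq_trans (size_polyD _ _) _; rewrite geq_max size_polyN.
  rewrite (leq_trans (size_polyC_leq1 _)) // andbT.
  by apply: leq_trans (size_scale_leq _ _) _; rewrite size_polyX.
split=> //.
- by move=> x; rewrite in_itv /= => /andP[].
- by move=> x; rewrite in_itv /= andbT.
- by move=> x; rewrite in_itv /= hornerXsubC subr_gt0 => /andP[].
- by move=> x; rewrite in_itv /= andbT hornerXsubC subr_gt0; exact: lt_trans.
- by rewrite hornerXsubC sub0r oppr_gt0.
- by rewrite size_XsubC.
- by rewrite lt ltrN10.
- rewrite tE !(hornerD, hornerN, hornerZ, hornerX, hornerXn, hornerC) expr0n /= !mulr0 !add0r.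
  by rewrite -mulrN mulr_gt0 // oppr_gt0.
Qed.

Lemma laguerre_hermite_system (R : realType) (g : R) (L1 L2 : {scalar {poly R}}) :
  -1 < g ->
  definite_on `]-oo, 0[ L1 -> definite_on `]0, +oo[ L2 ->
  pearson L1 1 (laguerre_hermite_theta g) ->
  pearson L2 1 (laguerre_hermite_theta g) ->
  pearson_system `]-oo, 0[ `]0, +oo[ L1 L2 1 (laguerre_hermite_theta g).
Proof.
move=> g1 d1 d2 e1 e2; have g10 : 0 < g + 1 by rewrite -ltrBlDr sub0r.
have tE : laguerre_hermite_theta g = (-2) *: 'X^2 + (g + 1)%:P.
  by rewrite /laguerre_hermite_theta -!mul_polyC; ring.
have [st lt] : size (laguerre_hermite_theta g) = 3%N /\
    lead_coef (laguerre_hermite_theta g) = -2.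
  rewrite tE; apply: size_quadratic; rewrite ?oppr_eq0 ?pnatr_eq0 //.
  by rewrite (leq_trans (size_polyC_leq1 _)).
split=> //.
- by move=> x; rewrite in_itv /= andbT.
- by move=> x _; rewrite hornerC.
- by move=> x _; rewrite hornerC.
- by rewrite hornerC.
- by rewrite (leq_trans (size_polyC_leq1 _)).
- by rewrite lt oppr_lt0.
- by rewrite tE hornerD hornerZ hornerXn hornerC expr0n mulr0 add0r.
Qed.

Lemma jacobi_laguerre_interlace (R : realType) (a b g : R) (m : nat) :
  a < 0 -> -1 < b -> -1 < g ->
  let L := jacobi_laguerre a in
  (interlace (L b g m.+1) (L (b + 1) g m.+1) /\
   interlace (L (b + 1) g m.+1) ('X * L (b + 1) (g + 1) m)) /\
  ((interlace_on `]a, 0[ (L b (g + 1) m.+1) (L b g m.+1) /\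
    interlace_on `]a, 0[ (L b g m.+1) (L (b + 1) (g + 1) m)) /\
   (interlace_on `]0, +oo[ (L b g m.+1) (L b (g + 1) m.+1) /\
    interlace_on `]0, +oo[ (L b (g + 1) m.+1) (L (b + 1) (g + 1) m))).
Proof.
move=> a0 b1 g1 L.
have [L1 [LE1 d1 e1]] := jacobi_laguerre_neg_form a0 b1 g1.
have [L2 [LE2 d2 e2]] := jacobi_laguerre_pos_form b a0 g1.
have sys := jacobi_laguerre_system a0 g1 d1 d2 e1 e2.
have m10 : -1 != 0 :> R by rewrite oppr_eq0 oner_eq0.
have xa (x : R) : 0 < x -> 0 < x - a by move=> x0; rewrite subr_gt0 (lt_trans a0).
have orthP n : multiple_orthogonal L1 L2 1 n (L b g n).
  apply: (jacobi_laguerre_orthogonal _ LE1 LE2 (angelesco_system1 sys) (oner_neq0 R)).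
    by move=> x _ _; rewrite hornerC !mul1r.
  by move=> x _; rewrite hornerC mul1r.
have orthS n : multiple_orthogonal L1 L2 'X n (L b (g + 1) n).
  apply: (jacobi_laguerre_orthogonal _ LE1 LE2 (angelesco_systemX sys) m10).
    by move=> x _ x0; rewrite hornerX powR_succr ?oppr_gt0 //; ring.
  by move=> x x0; rewrite hornerX powR_succr //; ring.
have orthT n : multiple_orthogonal L1 L2 ('X - a%:P) n (L (b + 1) g n).
  apply: (jacobi_laguerre_orthogonal _ LE1 LE2 (angelesco_system_kappa sys) (oner_neq0 R)).
    by move=> x ax _; rewrite hornerXsubC powR_succr ?subr_gt0 //; ring.
  by move=> x x0; rewrite hornerXsubC powR_succr ?xa //; ring.
have orthq n : multiple_orthogonal L1 L2 ('X * ('X - a%:P)) n (L (b + 1) (g + 1) n).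
  apply: (jacobi_laguerre_orthogonal _ LE1 LE2 (angelesco_systemX_kappa sys) m10).
    move=> x ax x0; rewrite hornerM hornerX hornerXsubC.
    by rewrite !powR_succr ?subr_gt0 ?oppr_gt0 //; ring.
  by move=> x x0; rewrite hornerM hornerX hornerXsubC !powR_succr ?xa //; ring.
split; last exact: pearson_interlace sys (orthq m) (orthP m.+1) (orthS m.+1).
exact: (pearson_interlace_kappa sys (orthq m) (orthP m.+1) (erefl ('X - a%:P)) (orthT m.+1)).
Qed.

Lemma laguerre_hermite_interlace (R : realType) (g : R) (m : nat) : -1 < g ->
  let H := @laguerre_hermite R in
  (interlace_on `]-oo, 0[ (H (g + 1) m.+1) (H g m.+1) /\
   interlace_on `]-oo, 0[ (H g m.+1) (H (g + 1) m)) /\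
  (interlace_on `]0, +oo[ (H g m.+1) (H (g + 1) m.+1) /\
   interlace_on `]0, +oo[ (H (g + 1) m.+1) (H (g + 1) m)).
Proof.
move=> g1 H.
have [[L2 [LE2 d2 e2]] [L1 [LE1 d1 e1]]] := laguerre_hermite_forms g1.
have sys := laguerre_hermite_system g1 d1 d2 e1 e2.
have m10 : -1 != 0 :> R by rewrite oppr_eq0 oner_eq0.
have orthP n : multiple_orthogonal L1 L2 1 n (H g n).
  apply: (laguerre_hermite_orthogonal _ LE1 LE2 (angelesco_system1 sys) (oner_neq0 R)).
    by move=> x _; rewrite hornerC !mul1r.
  by move=> x _; rewrite hornerC mul1r.
have orthS n : multiple_orthogonal L1 L2 'X n (H (g + 1) n).
  apply: (laguerre_hermite_orthogonal _ LE1 LE2 (angelesco_systemX sys) m10).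
    by move=> x x0; rewrite hornerX powR_succr ?oppr_gt0 //; ring.
  by move=> x x0; rewrite hornerX powR_succr // mulrC.
have orthq n : multiple_orthogonal L1 L2 ('X * 1) n (H (g + 1) n) by rewrite mulr1.
exact: pearson_interlace sys (orthq m) (orthP m.+1) (orthS m.+1).
Qed.

Theorem theorem2p5 (R : realType) (a beta gamma : R) (n : nat)
    (ha : a < 0) (hbeta : -1 < beta) (hgamma : -1 < gamma) (hn : (2 <= n)%N) :
  let L := jacobi_laguerre a in
  let H := @laguerre_hermite R in
  (interlace (L beta gamma n) (L (beta + 1) gamma n) /\
   interlace (L (beta + 1) gamma n)
             ('X * L (beta + 1) (gamma + 1) n.-1)) /\
  ((interlace_on `]a, 0[ (L beta (gamma + 1) n) (L beta gamma n) /\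
    interlace_on `]a, 0[ (L beta gamma n) (L (beta + 1) (gamma + 1) n.-1)) /\
   (interlace_on `]0, +oo[ (L beta gamma n) (L beta (gamma + 1) n) /\
    interlace_on `]0, +oo[ (L beta (gamma + 1) n)
                           (L (beta + 1) (gamma + 1) n.-1))) /\
  ((interlace_on `]-oo, 0[ (H (gamma + 1) n) (H gamma n) /\
    interlace_on `]-oo, 0[ (H gamma n) (H (gamma + 1) n.-1)) /\
   (interlace_on `]0, +oo[ (H gamma n) (H (gamma + 1) n) /\
    interlace_on `]0, +oo[ (H (gamma + 1) n) (H (gamma + 1) n.-1))).
Proof.
move=> L H; case: n hn => [//|m] _.
have [L12 L3] := jacobi_laguerre_interlace m ha hbeta hgamma.
exact: (conj L12 (conj L3 (laguerre_hermite_interlace m hgamma))).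
Qed.
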